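(* Let $f\in L^\infty(0,1)$ with $0\le f\le 1$ a.e. on $(0,1)$, and let $F:\mathbb{R}\to[0,\infty)$ satisfy (F1)--(F4). Let $\lambda>0$ satisfy $\lambda<\lambda_\infty(F)$. Then: (a) The problem of minimizing $J$ over $W^{1,1}(0,1)$ admits a unique solution $u\in W^{1,1}(0,1)$, and $0\le u(x)\le 1$ for all $x\in[0,1]$. (b) The relaxed problem of minimizing $K$ over $BV(0,1)$ has exactly one solution, and this solution coincides with $u$ from (a). (c) The minimizer $u$ belongs to $W^{2,\infty}(0,1)=C^{1,1}([0,1])$ and solves the Neumann-type boundary value problem $$\ddot u=\lambda\,\frac{u-f}{F''(\dot u)}\ \text{ a.e. on }(0,1),\qquad \dot u(0)=\dot u(1)=0.$$
   Context: Conditions on $F:\mathbb{R}\to[0,\infty)$ (for all $p\in\mathbb{R}$, with constants $\nu_1,\nu_2>0$, $\nu_3\in\mathbb{R}$): (F1) $F\in C^2(\mathbb{R})$, $F(-p)=F(p)$, $F(0)=0$; (F2) $|F'(p)|\le\nu_1$; (F3) $F(p)\ge\nu_2|p|-\nu_3$; (F4) $F''(p)>0$. Set $\lambda_\infty=\lambda_\infty(F):=\lim_{p\to\infty}F'(p)$, a positive number. For $w\in W^{1,1}(0,1)$ (absolutely continuous functions, identified with their continuous representatives on $[0,1]$), with weak derivative $\dot w$, $$J[w]:=\int_0^1F(\dot w)\,dt+\frac{\lambda}{2}\int_0^1(w-f)^2\,dt.$$ For $w\in BV(0,1)$ write the distributional derivative as $Dw=\dot w\,\mathcal{L}^1+D^sw$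 (Lebesgue decomposition with respect to Lebesgue measure $\mathcal{L}^1$; $\dot w$ is the density of the absolutely continuous part and $D^sw$ the singular part, $|D^sw|$ its total variation measure), and $$K[w]:=\int_0^1F(\dot w)\,dt+\lambda_\infty|D^sw|(0,1)+\frac{\lambda}{2}\int_0^1(w-f)^2\,dt.$$ $C^{1,1}([0,1])$ is the space of $C^1$ functions on $[0,1]$ with Lipschitz continuous derivative. *)

(* Defs.v *)
From HB Require Import structures.
From mathcomp Require Import all_boot all_order all_algebra.
From mathcomp Require Import all_classical all_reals all_analysis.

Set Implicit Arguments.
Unset Strict Implicit.
Unset Printing Implicit Defensive.

Import Order.TTheory GRing.Theory Num.Theory.
Import numFieldNormedType.Exports.

Local Open Scope ring_scope.
Local Open Scope classical_set_scope.

(* Functions on (0,1) or [0,1] are represented by total functions R -> R of   *)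
(* which only the values on the interval matter. Derivatives with respect to  *)
(* the interval are therefore never taken with the two-sided operator f^`().  *)

Section density.
Context {R : realType}.
Implicit Type F : R -> R.

Definition condF1 F :=
  [/\ (forall p, derivable F p 1), (forall p, derivable (derive1 F) p 1),
      continuous (derive1 (derive1 F)), (forall p, F (- p) = F p) & F 0 = 0].

Definition condF2 (nu1 : R) F := forall p, `|derive1 F p| <= nu1.

Definition condF3 (nu2 nu3 : R) F := forall p, nu2 * `|p| - nu3 <= F p.

Definition condF4 F := forall p, 0 < derive1 (derive1 F) p.

Definition lambda_infty F : R := lim (derive1 F p @[p --> +oo]).

End density.

Section charges.
Context d (T : measurableType d) {R : realType}.
Implicit Type nu : {charge set T -> \bar R}.

Definition hahn_pos nu : set T := sval (cid (Hahn_decomposition nu)).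

Definition hahn_neg nu : set T :=
  sval (cid (svalP (cid (Hahn_decomposition nu)))).

Definition hahn_posneg nu : hahn_decomposition nu (hahn_pos nu) (hahn_neg nu) :=
  svalP (cid (svalP (cid (Hahn_decomposition nu)))).

(* |nu| *)
Definition total_variation_charge nu : set T -> \bar R :=
  charge_variation (hahn_posneg nu).

(* integral of phi with respect to the signed measure nu = nu^+ - nu^- *)
Definition charge_integral nu (phi : T -> R) : R :=
  \int[jordan_pos (hahn_posneg nu)]_x phi x
  - \int[jordan_neg (hahn_posneg nu)]_x phi x.

Definition mutually_singular nu (mu : {measure set T -> \bar R}) :=
  exists N, [/\ measurable N, mu N = 0%E & total_variation_charge nu (~` N) = 0%E].

End charges.

Section function_spaces.
Context {R : realType}.
Local Notation mu := (@lebesgue_measure R).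
Local Notation I01 := (`]0%R, 1%R[%classic : set R).
Implicit Types (w g phi : R -> R) (nu s : {charge set (measurableTypeR R) -> \bar R}).

Definition L1 w := mu.-integrable I01 (EFin \o w).

Definition Linfty w := w \_ I01 \in Lfun mu +oo%E.

(* C_c^oo(0,1) *)
Definition test_function phi :=
  [/\ (forall n x, derivable (phi^`(n)) x 1),
      compact (closure [set x | phi x != 0]) &
      closure [set x | phi x != 0] `<=` I01].

Definition is_weak_derivative w g :=
  [/\ L1 w, L1 g &
      forall phi, test_function phi ->
        \int[mu]_(x in I01) (w x * derive1 phi x)
        = - \int[mu]_(x in I01) (g x * phi x)].

(* a representative of the weak derivative, which is unique up to equality    *)
(* a.e. on (0,1)                                                              *)
Definition weak_derivative w : R -> R := xget (fun=> 0) (is_weak_derivative w).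

(* W^{1,1}(0,1), each class being replaced by its continuous representative   *)
Definition W11 : set (R -> R) :=
  [set w : R -> R | {within `[0%R, 1%R], continuous w} /\
           exists g, is_weak_derivative w g].

Definition W2infty : set (R -> R) :=
  [set w : R -> R | exists g h, [/\ is_weak_derivative w g, is_weak_derivative g h,
                           Linfty w, Linfty g & Linfty h]].

(* Finite signed measures on (0,1) are encoded as charges on R that vanish    *)
(* on the measurable sets disjoint from (0,1).                                *)
Definition is_distributional_derivative w nu :=
  [/\ L1 w,
      (forall A : set (measurableTypeR R), measurable A -> A `&` I01 = set0 -> nu A = 0%E) &
      forall phi, test_function phi ->
        \int[mu]_(x in I01) (w x * derive1 phi x) = - charge_integral nu phi].

Definition BV : set (R -> R) :=
  [set w : R -> R | exists nu, is_distributional_derivative w nu].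

(* Dw; it is determined by w on the measurable sets *)
Definition distributional_derivative w :
    {charge set (measurableTypeR R) -> \bar R} :=
  @xget {classic {charge set (measurableTypeR R) -> \bar R}}
    (czero : {charge set (measurableTypeR R) -> \bar R})
    (is_distributional_derivative w).

Definition is_lebesgue_decomposition nu g s :=
  [/\ L1 g, mutually_singular s mu &
      forall A : set (measurableTypeR R), measurable A ->
        nu A = (\int[mu]_(x in A `&` I01) (g x)%:E + s A)%E].

Definition ac_density w : R -> R :=
  xget (fun=> 0) [set g | exists s,
    is_lebesgue_decomposition (distributional_derivative w) g s].

(* D^s w *)
Definition singular_part w : {charge set (measurableTypeR R) -> \bar R} :=
  @xget {classic {charge set (measurableTypeR R) -> \bar R}}
    (czero : {charge set (measurableTypeR R) -> \bar R})
    [set s | exists g,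
      is_lebesgue_decomposition (distributional_derivative w) g s].

(* classical derivative on [0,1], one-sided at the endpoints *)
Definition difference_quotient w x : R -> R := fun y => (w y - w x) / (y - x).

Definition derivative01 w x : R :=
  lim (difference_quotient w x y @[y --> within `[0%R, 1%R] x^']).

(* C^{1,1}([0,1]); continuity of the derivative follows from the last clause *)
Definition C11 : set (R -> R) :=
  [set w : R -> R | {in `[0%R, 1%R], forall x : R,
              cvg (difference_quotient w x y @[y --> within `[0%R, 1%R] x^'])} /\
           exists k : R, k.-lipschitz_(`[0%R, 1%R]%classic) (derivative01 w)].

End function_spaces.

Section functionals.
Context {R : realType}.
Local Notation mu := (@lebesgue_measure R).
Local Notation I01 := (`]0%R, 1%R[%classic : set R).
Local Open Scope ereal_scope.

(* All integrands are nonnegative when F is, so that J and K are well defined *)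
(* with values in [0, +oo].                                                   *)
Definition J (F f : R -> R) (lam : R) (w : R -> R) : \bar R :=
  \int[mu]_(t in I01) (F (weak_derivative w t))%:E
  + (lam / 2)%:E * \int[mu]_(t in I01) ((w t - f t) ^+ 2)%:E.

Definition K (F f : R -> R) (lam : R) (w : R -> R) : \bar R :=
  \int[mu]_(t in I01) (F (ac_density w t))%:E
  + (lambda_infty F)%:E * total_variation_charge (singular_part w) I01
  + (lam / 2)%:E * \int[mu]_(t in I01) ((w t - f t) ^+ 2)%:E.

End functionals.

Definition minimizes {R : realType} {T : Type} (E : T -> \bar R) (S : set T) (u : T) :=
  S u /\ forall v, S v -> (E u <= E v)%E.

(* Main.v *)
Require Import Defs.
From mathcomp Require Import all_boot all_order all_algebra.
From mathcomp Require Import all_classical all_reals all_analysis.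
From mathcomp Require Import measurable_realfun ess_sup_inf.
From mathcomp Require Import ring lra.

(** The minimizer is found by solving the Euler equation, and a calibration argument then shows
    that it beats every competitor in W^{1,1} and in BV by a quadratic margin. The three parts of
    the theorem thus concern one and the same function, and no compactness or
    relaxation argument is involved.

    The Euler equation is the planar system u' = g(s), s' = lam (u - f), s(0) = s(1) = 0, where s
    stands for F'(u') and g for the inverse of F'. As lam < lambda_infty, the range of F' covers
    [- lam, lam], and g can be taken to be the inverse of F' frozen outside [- lam, lam], which
    is bounded and Lipschitz ([truncated_inverse]). Picard iteration solves the initial value
    problem with u(0) = a, s(0) = 0, and shooting in the parameter a in [0, 1] achieves s(1) = 0
    ([boundary_value_problem]). By a maximum principle 0 <= u <= 1, so that |s| <= lam: the
    truncation of g is inactive. Hence q = g(s) is a continuous derivative of u that satisfies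
    F'(q) = s, vanishes at both ends, and is a primitive of lam (u - f) / F''(q)
    ([regular_solution]). This is all the regularity that (c) asks for.

    Let w be a competitor with Dw = g L^1 + D^s w. By convexity of F and expansion of the square,
      F(g) + lam/2 (w - f)^2 >= F(q) + lam/2 (u - f)^2 + lam/2 (w - u)^2
                                + s (g - q) + lam (u - f) (w - u)
    pointwise. The function s is the primitive of lam (u - f) and vanishes at both ends;
    integration by parts turns the integral of the last two terms into minus the integral of s
    against D^s w, which is at least - lam |D^s w| >= - lambda_infty |D^s w|. Therefore
    K[w] >= K[u] + lam/2 ||w - u||^2 ([energy_gap], [K_gap]), and the same with J when
    D^s w = 0 ([J_gap]). Minimality and uniqueness follow at once, since J[u] = K[u].

    What this takes from measure theory is that integration by parts holds against the primitive
    s although Dw is only tested against smooth functions, and that Dw and its Lebesgue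
    decomposition are unique, so that the chosen representatives are the expected ones. Both rest
    on distribution functions: a function with derivative nu is almost everywhere a constant plus
    the distribution function of nu ([distributional_distf], a form of du Bois-Reymond's lemma),
    and for distribution functions integration by parts is Fubini's theorem on a triangle
    ([fubini_ray], [charge_integral_prim]). *)

Set Implicit Arguments.
Unset Strict Implicit.
Unset Printing Implicit Defensive.

Import Order.TTheory GRing.Theory Num.Theory.
Import numFieldNormedType.Exports.

Local Open Scope ring_scope.
Local Open Scope classical_set_scope.

(** * Primitives of integrable functions on the unit interval *)
Section primitive.
Context {R : realType}.
Local Notation mu := (@lebesgue_measure R).
Local Notation I01 := (`]0%R, 1%R[%classic : set R).
Implicit Types (h g : R -> R) (x y : R).

(** Cutting the domain down to the unit interval makes a primitive a function on the
    whole line, constant outside [0, 1], that only involves the values of h on (0, 1). *)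
Definition prim h x : R := \int[mu]_(t in I01 `&` `]-oo, x]) h t.

Lemma mI01 : measurable (I01 : set (measurableTypeR R)).
Proof. exact: measurable_itv. Qed.
#[local] Hint Resolve mI01 : core.

Lemma mI01_ray x : measurable (I01 `&` `]-oo, x] : set (measurableTypeR R)).
Proof. exact: measurableI. Qed.
#[local] Hint Resolve mI01_ray : core.

Lemma mI01_itv x y : measurable (I01 `&` `]x, y] : set (measurableTypeR R)).
Proof. exact: measurableI. Qed.
#[local] Hint Resolve mI01_itv : core.

Lemma mu_I01 : mu I01 = 1%E.
Proof. by rewrite lebesgue_measure_itv/= lte_fin ltr01 -EFinB subr0. Qed.

Lemma L1_bounded h (M : R) : measurable_fun I01 h ->
  (forall t, I01 t -> `|h t| <= M) -> L1 h.
Proof.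
move=> mh hM; apply: measurable_bounded_integrable => //.
  by have := mu_I01 => /= ->; exact: ltry.
exists M; split; first exact: num_real.
by move=> x Mx t It; apply: (le_trans (hM _ It)); apply/ltW.
Qed.

Lemma L1_subset h (A : set R) : measurable (A : set (measurableTypeR R)) ->
  A `<=` I01 -> L1 h -> mu.-integrable A (EFin \o h).
Proof. by move=> mA AI; apply: integrableS. Qed.

Lemma L1_cst (c : R) : L1 (fun=> c).
Proof. by apply: (@L1_bounded _ `|c|) => //; exact: measurable_cst. Qed.

Lemma L1D h g : L1 h -> L1 g -> L1 (fun t => h t + g t).
Proof.
move=> ih ig; have := @integrableD _ _ _ mu _ mI01 _ _ ih ig.
by apply: eq_integrable.
Qed.

Lemma L1Z (c : R) h : L1 h -> L1 (fun t => c * h t).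
Proof.
move=> ih; have := @integrableZl _ _ _ mu _ mI01 c _ ih.
by apply: eq_integrable.
Qed.

Lemma L1B h g : L1 h -> L1 g -> L1 (fun t => h t - g t).
Proof.
move=> ih ig; have := @integrableB _ _ _ mu _ mI01 _ _ ih ig.
by apply: eq_integrable.
Qed.

Lemma L1M h g (M : R) : L1 h -> measurable_fun I01 g ->
  (forall t, I01 t -> `|g t| <= M) -> L1 (fun t => h t * g t).
Proof.
move=> ih mg gM; have := @integrableMl _ _ _ mu _ mI01 _ g ih mg.
move=> H; apply: eq_integrable (H _) => //.
exists M; split; first exact: num_real.
by move=> x Mx t It; apply: (le_trans (gM _ It)); apply/ltW.
Qed.

Lemma L1_measurable h : L1 h -> measurable_fun I01 h.
Proof. by move=> /integrableP[/measurable_EFinP]. Qed.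

Lemma prim_le0 h x : x <= 0 -> prim h x = 0.
Proof.
move=> x0; rewrite /prim (_ : _ `&` _ = set0) ?Rintegral_set0//.
apply/seteqP; split => // t [] /=; rewrite !in_itv/=; lra.
Qed.

Lemma prim_ge1 h x : 1 <= x -> prim h x = \int[mu]_(t in I01) h t.
Proof.
move=> x1; rewrite /prim setIidl// => t /=; rewrite !in_itv/=; lra.
Qed.

Lemma prim_sub h x y : L1 h -> x <= y ->
  prim h y - prim h x = \int[mu]_(t in I01 `&` `]x, y]) h t.
Proof.
move=> ih xy; rewrite /prim.
have -> : I01 `&` `]-oo, y] = (I01 `&` `]-oo, x]) `|` (I01 `&` `]x, y]).
  apply/seteqP; split => t /=; rewrite !in_itv/=; last by case=> -[]; lra.
  case=> ? ?; have [|] := leP t x; [left|right]; lra.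
rewrite Rintegral_setU//; first by rewrite addrC addKr.
  apply: L1_subset ih; first exact: measurableU.
  by move=> t [] [].
by apply/disj_setPS => t [] [_ /=] + [_ /=]; rewrite !in_itv/=; lra.
Qed.

Lemma mu_I01_itv_le x y : x <= y -> (mu (I01 `&` `]x, y]) <= (y - x)%:E)%E.
Proof.
move=> xy; apply: (@le_trans _ _ (mu `]x, y])).
  by apply: le_measure; rewrite ?inE//; exact: subIsetr.
by rewrite lebesgue_measure_itv/= lte_fin; case: ifPn => //; rewrite lee_fin subr_ge0.
Qed.

Lemma mu_I01_itv x y : 0 <= x -> x <= y -> y <= 1 ->
  (mu (I01 `&` `]x, y]) = (y - x)%:E)%E.
Proof.
move=> x0 xy y1; apply/eqP; rewrite eq_le mu_I01_itv_le//=.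
apply: (@le_trans _ _ (mu `]x, y[)).
  rewrite lebesgue_measure_itv/= lte_fin; case: ifPn => //.
  by rewrite -leNgt lee_fin subr_le0.
apply: le_measure; rewrite ?inE//.
by move=> t /=; rewrite !in_itv/=; lra.
Qed.

Lemma prim_sub_le h x y (M : R) : L1 h -> 0 <= M ->
  (forall t, I01 t -> `|h t| <= M) -> `|prim h y - prim h x| <= M * `|y - x|.
Proof.
move=> ih M0 hM.
wlog xy : x y / x <= y.
  move=> H; have [/H//|/ltW/H] := leP x y.
  by rewrite distrC (distrC y).
rewrite prim_sub// (ger0_norm (_ : 0 <= y - x)) ?subr_ge0//.
have ihxy : mu.-integrable (I01 `&` `]x, y]) (EFin \o h).
  by apply: L1_subset ih => // t [].
apply: (le_trans (le_normr_Rintegral _ ihxy)) => //.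
apply: (@le_trans _ _ (\int[mu]_(t in I01 `&` `]x, y]) M)).
  apply: le_Rintegral => //.
  - exact: integrable_norm.
  - apply: (L1_subset _ _ (L1_cst M)) => // t [].
  - by move=> t [It _]; exact: hM.
rewrite Rintegral_cst// ler_wpM2l//.
rewrite -lee_fin fineK ?mu_I01_itv_le//.
by rewrite ge0_fin_numE// (le_lt_trans (mu_I01_itv_le xy))// ltry.
Qed.

Lemma prim_sub_approx h x y (c e : R) : L1 h -> 0 <= x -> x <= y -> y <= 1 ->
  (forall t, I01 t -> x < t <= y -> `|h t - c| <= e) ->
  `|prim h y - prim h x - c * (y - x)| <= e * (y - x).
Proof.
move=> ih x0 xy y1 hc; rewrite prim_sub//.
have Ec (k : R) : k * (y - x) = \int[mu]_(t in I01 `&` `]x, y]) k.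
  by have /= E := mu_I01_itv x0 xy y1; rewrite Rintegral_cst//= E.
have ihxy : mu.-integrable (I01 `&` `]x, y]) (EFin \o h).
  by apply: L1_subset ih => // t [].
have icxy k : mu.-integrable (I01 `&` `]x, y]) (EFin \o fun=> k).
  by apply: (L1_subset _ _ (L1_cst k)) => // t [].
rewrite !Ec -RintegralB//.
have ihc : mu.-integrable (I01 `&` `]x, y]) (EFin \o (fun t => h t - c)).
  by apply: L1_subset (L1B ih (L1_cst c)) => // t [].
apply: (le_trans (le_normr_Rintegral _ ihc)) => //.
apply: le_Rintegral => //; first exact: (integrable_norm ihc).
by move=> t [It]; rewrite /= in_itv/= => txy; exact: hc.
Qed.

Lemma primB h g x : L1 h -> L1 g ->
  prim (fun t => h t - g t) x = prim h x - prim g x.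
Proof. by move=> ih ig; rewrite /prim RintegralB//; apply: L1_subset => // t []. Qed.

Lemma primZ (c : R) h x : L1 h -> prim (fun t => c * h t) x = c * prim h x.
Proof. by move=> ih; rewrite /prim RintegralZl//; apply: L1_subset => // t []. Qed.

Lemma eq_prim h g x : (forall t, I01 t -> h t = g t) -> prim h x = prim g x.
Proof. by move=> hg; apply: eq_Rintegral => t; rewrite inE => -[It _]; exact: hg. Qed.

Lemma le_prim h g x : L1 h -> L1 g -> (forall t, I01 t -> h t <= g t) ->
  prim h x <= prim g x.
Proof.
move=> ih ig hg; apply: le_Rintegral => //; try by apply: L1_subset => // t [].
by move=> t [It _]; exact: hg.
Qed.

Lemma norm_prim_le h x : L1 h -> `|prim h x| <= prim (fun t => `|h t|) x.
Proof. by move=> ih; apply: le_normr_Rintegral => //; apply: L1_subset ih => // t []. Qed.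

Lemma lipschitz_cont (g : R -> R) (M : R) :
  (forall x y, `|g y - g x| <= M * `|y - x|) -> continuous g.
Proof.
move=> gM x; apply/cvgrPdist_lt => e e0.
have M1 : 0 < `|M| + 1 by apply: ltr_wpDl.
apply/nbhs_ballP; exists (e / (`|M| + 1)) => /=; first exact: divr_gt0.
move=> y; rewrite /ball/= => xy; rewrite distrC.
apply: (le_lt_trans (gM _ _)).
apply: (@le_lt_trans _ _ ((`|M| + 1) * `|y - x|)).
  by apply: ler_wpM2r => //; apply: (le_trans (ler_norm M)); lra.
by rewrite -ltr_pdivlMl// mulrC distrC.
Qed.

Lemma prim_continuous h (M : R) : measurable_fun I01 h -> 0 <= M ->
  (forall t, I01 t -> `|h t| <= M) -> continuous (prim h).
Proof.
move=> mh M0 hM; apply: (@lipschitz_cont _ M) => x y.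
by apply: prim_sub_le => //; exact: L1_bounded hM.
Qed.

(** First-order approximation rather than a limit of quotients: this is the form in which
    estimates on primitives arrive. *)
Lemma is_derive_approx (f : R -> R) (x c : R) :
  (forall e : R, 0 < e -> exists2 d : R, 0 < d & forall y, `|y - x| < d ->
     `|f y - f x - c * (y - x)| <= e * `|y - x|) ->
  is_derive x 1 f c.
Proof.
move=> H.
have cv : h^-1 *: ((f \o shift x) (h *: 1) - f x) @[h --> 0^'] --> c.
  apply/cvgrPdist_le => e e0; have [d d0 Hd] := H _ e0.
  near=> h; have h0 : h != 0 by near: h; exact: nbhs_dnbhs_neq.
  have hd : `|h| < d.
    near: h; apply: dnbhs0_lt => //.
  have := Hd (h + x); rewrite /= addrK => /(_ hd) Hh.
  rewrite /= -[h *: 1]/(h * 1) mulr1 distrC.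
  rewrite -(ler_pM2l (_ : 0 < `|h|)) ?normr_gt0// -normrM mulrBr.
  rewrite -[_ *: _]/(_ * _) mulrA divff// mul1r (mulrC h c).
  by rewrite (mulrC `|h|).
split; first by apply/cvg_ex; exists c.
exact: cvg_lim.
Unshelve. all: by end_near. Qed.

Lemma is_derive_approxE (f : R -> R) (x c : R) : is_derive x 1 f c ->
  forall e : R, 0 < e -> exists2 d : R, 0 < d & forall y, `|y - x| < d ->
     `|f y - f x - c * (y - x)| <= e * `|y - x|.
Proof.
move=> [df Df] e e0.
have : h^-1 *: ((f \o shift x) (h *: 1) - f x) @[h --> 0^'] --> c by rewrite -Df.
move=> /cvgrPdist_le/(_ e e0)/nbhs_ballP[d /= d0 Hd].
exists d => // y yxd; have [->|yx] := eqVneq y x.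
  by rewrite !subrr mulr0 subr0 normr0 mulr0.
have := Hd (y - x); rewrite /ball/= sub0r normrN => /(_ yxd).
rewrite subr_eq0 => /(_ yx).
rewrite -[(y - x) *: 1]/((y - x) * 1) mulr1 subrK.
rewrite -[_ *: _]/(_ * _) => H.
have yx0 : y - x != 0 by rewrite subr_eq0.
rewrite -ler_pdivrMr ?normr_gt0// -normfV -normrM.
by rewrite distrC in H; rewrite mulrBl mulfK// (mulrC _^-1) in H *.
Qed.

Definition clamp (a b x : R) := Num.max a (Num.min b x).

Lemma clamp_itv (a b x : R) : a <= b -> a <= clamp a b x <= b.
Proof. by move=> ab; rewrite /clamp le_max lexx/= ge_max ab ge_min lexx. Qed.

Lemma clamp_id (a b x : R) : a <= x <= b -> clamp a b x = x.
Proof.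
move=> /andP[ax xb]; rewrite /clamp; apply/eqP.
by rewrite (min_idPr xb) (max_idPr ax).
Qed.

Lemma clamp_le (a b x y : R) : x <= y -> clamp a b x <= clamp a b y.
Proof. by move=> xy; rewrite /clamp le_max2 // le_min2. Qed.

Lemma clamp_lip (a b x y : R) : `|clamp a b x - clamp a b y| <= `|x - y|.
Proof.
wlog xy : x y / y <= x.
  move=> H; have [/H//|/ltW/H] := leP y x.
  by rewrite distrC (distrC y).
rewrite !ger0_norm ?subr_ge0 ?clamp_le// lerBlDr {1}/clamp ge_max; apply/andP; split.
  by apply: ler_wpDl; rewrite ?subr_ge0// /clamp le_max lexx.
apply: (@le_trans _ _ (x - y + Num.min b y)); last by rewrite lerD2l /clamp le_max lexx orbT.
by rewrite -lerBlDl le_min !lerBlDl !ge_min; apply/andP; split; apply/orP; [left|right]; lra.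
Qed.

(** Composing D with the clamp to [0, 1] gives a function with zero derivative on the whole
    line, so that the endpoints need no separate treatment. *)
Lemma constant_of_flat (D : R -> R) :
  (forall x, 0 <= x <= 1 -> forall e : R, 0 < e -> exists2 d : R, 0 < d &
     forall y, 0 <= y <= 1 -> `|y - x| < d -> `|D y - D x| <= e * `|y - x|) ->
  forall x, 0 <= x <= 1 -> D x = D 0.
Proof.
move=> H x x01; rewrite -[in LHS](clamp_id x01).
rewrite -[in RHS](@clamp_id 0 1 0) ?lexx ?ler01//.
apply: (@is_derive_0_is_cst _ (D \o clamp 0 1)) => z.
apply: is_derive_approx => e e0.
have [d d0 Hd] := H _ (clamp_itv z ler01) _ e0.
exists d => // y yz; rewrite mul0r subr0 /=.
have cyz := clamp_lip 0 1 y z.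
apply: (le_trans (Hd _ (clamp_itv y ler01) _)); first exact: le_lt_trans yz.
by rewrite ler_wpM2l// ltW.
Qed.

Lemma prim_approx h x (e d : R) : L1 h -> 0 <= x <= 1 ->
  (forall t : R, 0 <= t <= 1 -> `|t - x| < d -> `|h t - h x| <= e) ->
  forall y, 0 <= y <= 1 -> `|y - x| < d ->
    `|prim h y - prim h x - h x * (y - x)| <= e * `|y - x|.
Proof.
move=> ih /andP[x0 x1] hx y /andP[y0 y1] yxd; have [xy|/ltW yx] := leP x y.
  rewrite (@ger0_norm _ (y - x)) ?subr_ge0//.
  apply: prim_sub_approx => // t /= It /andP[xt ty]; apply: hx; first lra.
  rewrite gtr0_norm ?subr_gt0//; apply: le_lt_trans yxd.
  by rewrite ger0_norm; lra.
have -> : prim h y - prim h x - h x * (y - x) =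
    - (prim h x - prim h y - h x * (x - y)) by ring.
rewrite normrN (distrC y x) (@ger0_norm _ (x - y)) ?subr_ge0//.
apply: prim_sub_approx => // t /= It /andP[xt ty]; apply: hx; first lra.
apply: le_lt_trans yxd.
by rewrite ler0_norm ?ler0_norm; lra.
Qed.

Lemma continuous_bounded01 g : continuous g ->
  exists2 M : R, 0 <= M & forall t, I01 t -> `|g t| <= M.
Proof.
move=> cg.
have cn : continuous (fun t => `|g t|) by move=> t; apply: cvg_norm; exact: cg.
have [t0 _ Ht0] := EVT_max ler01 (continuous_subspaceT cn).
exists `|g t0| => // t /=; rewrite in_itv/= => /andP[x0 x1].
by apply: Ht0; rewrite in_itv/= !ltW.
Qed.

Lemma L1_continuous g : continuous g -> L1 g.
Proof.
move=> cg; have [M _ gM] := continuous_bounded01 cg.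
apply: (@L1_bounded _ M) => //.
by apply: measurable_funTS; exact: continuous_measurable_fun.
Qed.

(** Both sides have the same first-order expansion, one-sided at the endpoints, so that
    their difference is flat. *)
Lemma prim_derive (f g : R -> R) : (forall x : R, is_derive x 1 f (g x)) ->
  continuous g -> forall x, 0 <= x <= 1 -> prim g x = f x - f 0.
Proof.
move=> df cg x x01.
suff : prim g x - f x = prim g 0 - f 0.
  by rewrite (@prim_le0 _ 0)// sub0r => /eqP; rewrite subr_eq addrC => /eqP.
apply: (@constant_of_flat (fun y => prim g y - f y)) x01 => y y01 e e0.
have e20 : 0 < e / 2 by rewrite divr_gt0.
have [d1 d10 H1] := is_derive_approxE (df y) e20.
have /cvgrPdist_le /(_ _ e20)/nbhs_ballP[d2 /= d20 H2] := cg y.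
exists (Num.min d1 d2); first by rewrite lt_min d10.
move=> t t01; rewrite lt_min => /andP[td1 td2].
have A1 := H1 _ td1.
have A2 : `|prim g t - prim g y - g y * (t - y)| <= e / 2 * `|t - y|.
  apply: (@prim_approx _ _ _ d2) => //; first exact: L1_continuous.
  by move=> r r01 ryd; rewrite distrC; apply: H2; rewrite /ball/= distrC.
have -> : prim g t - f t - (prim g y - f y) =
    (prim g t - prim g y - g y * (t - y)) - (f t - f y - g y * (t - y)) by ring.
apply: (le_trans (ler_normB _ _)).
have -> : e * `|t - y| = e / 2 * `|t - y| + e / 2 * `|t - y| by rewrite -mulrDl -splitr.
exact: lerD.
Qed.

(** As g vanishes outside (0, 1), its primitive is an ordinary indefinite integral on the
    line, to which the fundamental theorem of calculus applies at every point. *)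
Lemma prim_is_derive (g : R -> R) : continuous g -> (forall x, ~ I01 x -> g x = 0) ->
  forall x : R, is_derive x 1 (prim g) (g x).
Proof.
move=> cg g0 x.
have gI : g \_ I01 = g.
  apply/funext => t; rewrite patchE; case: ifPn => //.
  by rewrite notin_setE => /g0.
have primE : prim g = fun y => \int[mu]_(t in `]-oo, y]) g t.
  by apply/funext => y; rewrite /prim Rintegral_mkcondl gI.
have ig : mu.-integrable `]-oo, (x + 1)] (EFin \o g).
  apply: (@integrableS _ _ _ mu setT) => //.
  have /(integrable_mkcond _ mI01) := L1_continuous cg.
  by rewrite restrict_EFin gI.
have x1 : x < x + 1 by rewrite ltrDl.
have [] := @continuous_FTC1 R g -oo%O x (x + 1) x1 ig (ltNyr _) (cg x).
rewrite -primE => dF EF; rewrite -EF derive1E; exact: derivableP.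
Qed.

(** Integrating the exponential weight gains a factor 1 / k; with k large this makes an
    integral operator contract on the whole unit interval at once. *)
Lemma prim_expR (k C x : R) : 0 < k -> 0 <= C ->
  prim (fun t => C * expR (k * t)) x <= C / k * expR (k * x).
Proof.
move=> k0 C0.
have ce : continuous (fun t : R => C * expR (k * t)).
  move=> t; apply: cvgMr; apply: continuous_comp; first exact: mulrl_continuous.
  exact: continuous_expR.
have [x0|/ltW x0] := leP x 0.
  by rewrite prim_le0// mulr_ge0 ?expR_ge0// divr_ge0// ltW.
have dE (y : R) : is_derive y 1 (fun t => C / k * expR (k * t)) (C * expR (k * y)).
  apply: is_derive_eq.
  rewrite !scaler1/=.
  by rewrite -[_ *: _]/(_ * _); field; rewrite gt_eqF.
have H01 z : 0 <= z <= 1 -> prim (fun t => C * expR (k * t)) z <= C / k * expR (k * z).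
  move=> z01; rewrite (prim_derive dE ce z01) gerBl.
  by rewrite mulr_ge0 ?expR_ge0// divr_ge0// ltW.
have [x1|/ltW x1] := leP x 1; first by apply: H01; rewrite x0 x1.
rewrite prim_ge1// -(@prim_ge1 _ 1)//; apply: (le_trans (H01 _ _)).
  by rewrite ler01 lexx.
rewrite ler_wpM2l ?divr_ge0 ?(ltW k0)// ler_expR.
by rewrite ler_pM2l.
Qed.

Lemma prim_sub_ge h (x y m : R) : L1 h -> 0 <= x -> x <= y -> y <= 1 ->
  (forall t, I01 t -> x < t <= y -> m <= h t) -> m * (y - x) <= prim h y - prim h x.
Proof.
move=> ih x0 xy y1 mh; rewrite prim_sub//.
have mA : measurable (I01 `&` `]x, y] : set (measurableTypeR R)) by exact: mI01_itv.
have -> : m * (y - x) = \int[mu]_(t in I01 `&` `]x, y]) m.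
  by have /= E := mu_I01_itv x0 xy y1; rewrite Rintegral_cst//= E.
apply: le_Rintegral => //.
- by apply: L1_subset (L1_cst m) => // t [].
- by apply: L1_subset ih => // t [].
- by move=> t [It /=]; rewrite in_itv/=; exact: mh.
Qed.

Lemma prim_sub_le_cst h (x y m : R) : L1 h -> 0 <= x -> x <= y -> y <= 1 ->
  (forall t, I01 t -> x < t <= y -> h t <= m) -> prim h y - prim h x <= m * (y - x).
Proof.
move=> ih x0 xy y1 hm.
have ihN : L1 (fun t => -1 * h t) by exact: L1Z.
have := @prim_sub_ge (fun t => -1 * h t) x y (- m) ihN x0 xy y1.
rewrite !primZ// => H; rewrite -lerN2 -mulNr; apply: (le_trans (H _)); last by lra.
by move=> t It xty; rewrite mulN1r lerN2; exact: hm.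
Qed.

End primitive.

(** * The initial value problem *)
Section geometric.
Context {R : realType}.

Lemma lim_dist_le (u : R^nat) (l a B : R) : u @ \oo --> l ->
  (\forall n \near \oo, `|u n - a| <= B) -> `|l - a| <= B.
Proof.
move=> ul uB.
have H : `|u n - a| @[n --> \oo] --> `|l - a|.
  by apply: cvg_norm; apply: cvgB => //; exact: cvg_cst.
rewrite -(cvg_lim _ H)//; apply: limr_le => //; exact: cvgP H.
Qed.

Lemma geometric_eq0 (a C : R) : (forall n, `|a| <= C * 2^-1 ^+ n) -> a = 0.
Proof.
move=> aC; apply/eqP; rewrite -normr_le0.
have H : C * 2^-1 ^+ n @[n --> \oo] --> 0.
  rewrite -[X in _ --> X](mulr0 C); apply: cvgMr.
  by apply: cvg_expr; rewrite ger0_norm// invf_lt1 ?ltr1n.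
rewrite -(cvg_lim _ H)//; apply: limr_ge => //; first exact: cvgP H.
by apply: nearW.
Qed.

Lemma geometric_cvg (u : R^nat) (K : R) :
  (forall n, `|u n.+1 - u n| <= K * 2^-1 ^+ n) ->
  u @ \oo --> limn u /\ forall n, `|limn u - u n| <= 2 * K * 2^-1 ^+ n.
Proof.
move=> uK.
have K0 : 0 <= K by have := uK 0%N; rewrite expr0 mulr1; exact: le_trans.
have tail n m : `|u (n + m)%N - u n| <= 2 * K * 2^-1 ^+ n.
  have H : `|u (n + m)%N - u n| <= 2 * K * 2^-1 ^+ n - 2 * K * 2^-1 ^+ (n + m)%N.
    elim: m => [|m IH]; first by rewrite addn0 !subrr normr0.
    rewrite addnS; have := uK (n + m)%N.
    have := ler_normD (u (n + m).+1 - u (n + m)%N) (u (n + m)%N - u n).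
    rewrite addrA subrK exprS; lra.
  by apply: (le_trans H); rewrite gerDl oppr_le0 mulr_ge0 ?mulr_ge0.
have cu : cvgn u.
  have := telescopeK u => /(congr1 (fun s n => u 0%N + s n)).
  rewrite (_ : (fun n => u 0%N + [sequence u n0 - u 0%N]_n0 n) = u); last first.
    by apply/funext => n /=; rewrite addrC subrK.
  move=> <-; apply: is_cvgD; first exact: is_cvg_cst.
  apply: normed_cvg; apply: (@series_le_cvg _ _ (geometric K 2^-1)).
  - by move=> n /=.
  - by move=> n; rewrite /= mulr_ge0.
  - exact: uK.
  - by apply: is_cvg_geometric_series; rewrite ger0_norm// invf_lt1 ?ltr1n.
split=> // n; apply: (@lim_dist_le u) => //.
near=> m; have nm : (n <= m)%N by near: m; exact: nbhs_infty_ge.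
by rewrite -(subnKC nm).
Unshelve. all: by end_near. Qed.

End geometric.

Section picard.
Context {R : realType}.
Local Notation I01 := (`]0%R, 1%R[%classic : set R).
Variables (L M : R) (h : bool -> R -> R -> R).
Hypothesis L0 : 0 < L.
Hypothesis M0 : 0 <= M.
Hypothesis mh : forall b z, continuous z -> measurable_fun I01 (fun t => h b t (z t)).
Hypothesis hM : forall b t z, I01 t -> `|h b t z| <= M.
Hypothesis hL : forall b t z z', I01 t -> `|h b t z - h b t z'| <= L * `|z - z'|.
Implicit Types (c : bool -> R) (Z : bool -> R -> R).

(** The two unknowns of a planar system are indexed by booleans, each one being driven by
    the other. The right-hand side h is only measurable in time, whence integral equations
    instead of differential ones. *)
Definition picard_step c Z b x := c b + prim (fun t => h b t (Z (~~ b) t)) x.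

Definition picard c n := iter n (picard_step c) (fun b => cst (c b)).

Definition picard_lim c b x := limn (fun n => picard c n b x).

(** In the supremum norm divided by this weight the Picard step halves distances, so that the
    iteration converges on the whole unit interval and no local solutions have to be glued. *)
Let weight (x : R) := expR (2 * L * `|x|).

Let weight_ge1 x : 1 <= weight x.
Proof. by rewrite /weight -expR0 ler_expR !mulr_ge0// ltW. Qed.

Let L1_h b Z : (forall b, continuous (Z b)) -> L1 (fun t => h b t (Z (~~ b) t)).
Proof. by move=> cZ; apply: (@L1_bounded _ _ M) => [|t It]; [exact: mh|exact: hM]. Qed.

Lemma picard_step_lip c Z b x y : (forall b, continuous (Z b)) ->
  `|picard_step c Z b y - picard_step c Z b x| <= M * `|y - x|.
Proof.
move=> cZ; rewrite /picard_step opprD addrACA subrr add0r.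
by apply: prim_sub_le => // [|t It]; [exact: L1_h|exact: hM].
Qed.

Lemma picard_continuous c n b : continuous (picard c n b).
Proof.
elim: n b => [|n IH] b; first exact: cst_continuous.
by apply: (@lipschitz_cont _ _ M) => x y; exact: picard_step_lip.
Qed.

Lemma picard_step_contract c c' Z Z' (d E : R) :
  (forall b, continuous (Z b)) -> (forall b, continuous (Z' b)) ->
  (forall b, `|c b - c' b| <= d) ->
  (forall b x, `|Z b x - Z' b x| <= E * weight x) ->
  forall b x, `|picard_step c Z b x - picard_step c' Z' b x| <= d + E / 2 * weight x.
Proof.
move=> cZ cZ' cd ZE b x; rewrite /picard_step opprD addrACA.
have E0 : 0 <= E.
  have := ZE true 0; rewrite /weight normr0 mulr0 expR0 mulr1; exact: le_trans.
apply: (le_trans (ler_normD _ _)); apply: lerD => //.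
rewrite -primB; [|exact: L1_h..].
have [x0|/ltW x0] := leP x 0.
  rewrite prim_le0// normr0 mulr_ge0 ?divr_ge0//.
  exact: le_trans (weight_ge1 x).
apply: (le_trans (norm_prim_le _ _)); first by apply: L1B; exact: L1_h.
have k0 : 0 < 2 * L by rewrite mulr_gt0.
apply: (@le_trans _ _ (prim (fun t => L * E * expR (2 * L * t)) x)).
  have cE : continuous (fun t : R => L * E * expR (2 * L * t)).
    move=> t; apply: cvgMr; apply: continuous_comp; first exact: mulrl_continuous.
    exact: continuous_expR.
  apply: le_prim.
  - by apply: integrable_norm; apply: L1B; exact: L1_h.
  - apply: (@L1_bounded _ _ (L * E * expR (2 * L))) => [|t /=].
      by apply: measurable_funTS; exact: continuous_measurable_fun.
    have LE0 : 0 <= L * E by rewrite mulr_ge0// ltW.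
    rewrite in_itv/= => /andP[t0 t1]; rewrite ger0_norm; last first.
      by apply: mulr_ge0 => //; exact: expR_ge0.
    by rewrite ler_wpM2l// ler_expR ger_pMr// ltW.
  - move=> t It; apply: (le_trans (hL _ _ _ It)); rewrite -mulrA ler_pM2l//.
    apply: (le_trans (ZE _ _)); rewrite /weight ger0_norm//.
    by move: It; rewrite /= in_itv/= => /andP[/ltW].
apply: (le_trans (prim_expR _ k0 _)); first by rewrite mulr_ge0// ltW.
rewrite /weight (ger0_norm x0) (_ : L * E / (2 * L) = E / 2)//.
by field; rewrite gt_eqF.
Qed.

Lemma picard_geometric c n b x :
  `|picard c n.+1 b x - picard c n b x| <= M * weight x * 2^-1 ^+ n.
Proof.
elim: n b x => [|n IH] b x.
  rewrite expr0 mulr1 /= /picard_step addrC addKr.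
  have [x0|/ltW x0] := leP x 0.
    by rewrite prim_le0// normr0 mulr_ge0// (le_trans _ (weight_ge1 x)).
  rewrite -[prim _ x]subr0 -[X in _ - X](@prim_le0 _ (fun t => h b t (cst (c (~~ b)) t)) 0)//.
  have [x1|/ltW x1] := leP x 1.
    apply: (@le_trans _ _ (M * `|x - 0|)).
      apply: prim_sub_le => // [|t It]; last exact: hM.
      by apply: (@L1_h b (fun b' => cst (c b'))) => b'; exact: cst_continuous.
    rewrite ler_wpM2l// subr0 ger0_norm//; apply: le_trans x1 _; exact: weight_ge1.
  rewrite prim_ge1// -(@prim_ge1 _ _ 1)//.
  apply: (@le_trans _ _ (M * `|1 - 0|)).
    apply: prim_sub_le => // [|t It]; last exact: hM.
    by apply: (@L1_h b (fun b' => cst (c b'))) => b'; exact: cst_continuous.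
  by rewrite subr0 normr1 ler_wpM2l.
have := @picard_step_contract c c (picard c n.+1) (picard c n) 0 (M * 2^-1 ^+ n).
move=> /(_ (@picard_continuous c n.+1) (@picard_continuous c n)).
have H0 : forall b, `|c b - c b| <= 0 by move=> b'; rewrite subrr normr0.
have H1 : forall b x, `|picard c n.+1 b x - picard c n b x| <= M * 2^-1 ^+ n * weight x.
  by move=> b' x'; rewrite mulrAC; exact: IH.
move=> /(_ H0 H1 b x); rewrite add0r /= => H; apply: (le_trans H).
by rewrite exprS le_eqVlt; apply/orP; left; apply/eqP; ring.
Qed.

Lemma picard_cvg c b x : picard c n b x @[n --> \oo] --> picard_lim c b x.
Proof. by have [] := geometric_cvg (fun n => picard_geometric c n b x). Qed.

Lemma picard_lim_dist c n b x :
  `|picard_lim c b x - picard c n b x| <= 2 * (M * weight x) * 2^-1 ^+ n.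
Proof. by have [_] := geometric_cvg (fun n => picard_geometric c n b x). Qed.

Lemma picard_lim_lip c b x y :
  `|picard_lim c b y - picard_lim c b x| <= M * `|y - x|.
Proof.
rewrite -[_ - _]subr0; apply: (@lim_dist_le _ (fun n => picard c n b y - picard c n b x)).
  by apply: cvgB; exact: picard_cvg.
apply: nearW => -[|n]; rewrite subr0; first by rewrite subrr normr0 mulr_ge0.
by apply: picard_step_lip; exact: picard_continuous.
Qed.

Lemma picard_lim_continuous c b : continuous (picard_lim c b).
Proof. by apply: (@lipschitz_cont _ _ M) => x y; exact: picard_lim_lip. Qed.

Lemma picard_lim_eq c b x : picard_lim c b x =
  c b + prim (fun t => h b t (picard_lim c (~~ b) t)) x.
Proof.
apply/eqP; rewrite -subr_eq0; apply/eqP.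
apply: (@geometric_eq0 _ _ (2 * M * weight x)) => n.
have A := picard_lim_dist c n.+1 b x.
have := @picard_step_contract c c (picard c n) (picard_lim c) 0 (2 * M * 2^-1 ^+ n).
move=> /(_ (@picard_continuous c n) (@picard_lim_continuous c)).
have H0 : forall b, `|c b - c b| <= 0 by move=> b'; rewrite subrr normr0.
have H1 : forall b x, `|picard c n b x - picard_lim c b x| <= 2 * M * 2^-1 ^+ n * weight x.
  by move=> b' x'; rewrite distrC mulrAC -(mulrA 2); exact: picard_lim_dist.
move=> /(_ H0 H1 b x); rewrite add0r => B.
have -> : picard_lim c b x - (c b + prim (fun t => h b t (picard_lim c (~~ b) t)) x)
  = (picard_lim c b x - picard c n.+1 b x) +
    (picard_step c (picard c n) b x - picard_step c (picard_lim c) b x).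
  by rewrite -[picard c n.+1 b x]/(picard_step c (picard c n) b x) addrA subrK.
apply: (le_trans (ler_normD _ _)); apply: (le_trans (lerD A B)).
by rewrite exprS le_eqVlt; apply/orP; left; apply/eqP; field.
Qed.

(** The two iterations, run in parallel, stay close because the step is a contraction that
    only adds the distance of the initial values. *)
Lemma picard_lim_dep c c' (d : R) : (forall b, `|c b - c' b| <= d) ->
  forall b x, `|picard_lim c b x - picard_lim c' b x| <= 2 * d * weight x.
Proof.
move=> cd b x.
have d0 : 0 <= d by exact: le_trans (cd true).
rewrite -[_ - _]subr0; apply: (@lim_dist_le _ (fun n => picard c n b x - picard c' n b x)).
  by apply: cvgB; exact: picard_cvg.
apply: nearW => n; rewrite subr0; elim: n b x => [|n IH] b x.
  rewrite /= /cst; apply: (le_trans (cd b)); rewrite -mulrA mulrCA ler_peMr//.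
  have := weight_ge1 x; lra.
have := @picard_step_contract c c' (picard c n) (picard c' n) d (2 * d).
move=> /(_ (@picard_continuous c n) (@picard_continuous c' n) cd IH b x) H.
apply: (le_trans H); rewrite (_ : 2 * d / 2 = d); last by field.
by have := weight_ge1 x; nra.
Qed.

(** Each iterate satisfies a condition that one step preserves, and a closed condition passes
    to the limit. *)
Lemma picard_lim_invariant c (P : bool -> set R) :
  (forall b, closed (P b)) -> (forall b, P b (c b)) ->
  (forall Z, (forall b, continuous (Z b)) -> (forall b x, P b (Z b x)) ->
     forall b x, P b (picard_step c Z b x)) ->
  forall b x, P b (picard_lim c b x).
Proof.
move=> cP Pc Pstep b x.
apply: (@closed_cvg _ _ _ _ (fun n => picard c n b x) (P b)) => //; first exact: eventually_filter; last exact: picard_cvg.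
apply: nearW => n; elim: n b x => [|n IH] b x; first exact: Pc.
by apply: Pstep => //; exact: picard_continuous.
Qed.

End picard.

(** * The shooting method *)
Section shooting.
Context {R : realType}.
Local Notation mu := (@lebesgue_measure R).
Local Notation I01 := (`]0%R, 1%R[%classic : set R).
Implicit Types (h k u s g : R -> R).

(** At a maximum point c of u with u c > 1 the function s increases strictly near c. If
    s c >= 0 and c < 1, then s > 0 just after c and u would increase there; hence s c < 0
    unless c = 1. In the same way s c > 0 unless c = 0. Since s vanishes at 0 and at 1, every
    case is contradictory. The slope k of s is left abstract, for the lemma is applied to
    1 - u as well as to u. *)
Lemma maximum_principle (a : R) u s k g : continuous u -> continuous s ->
  L1 (g \o s) -> L1 k ->
  (forall x, u x = a + prim (g \o s) x) -> (forall x, s x = prim k x) -> s 1 = 0 ->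
  {homo g : x y / x <= y} -> g 0 = 0 -> (forall z : R, 0 < z -> 0 < g z) ->
  (forall z : R, z < 0 -> g z < 0) ->
  (forall e : R, 0 < e -> exists2 d : R, 0 < d &
     forall t, I01 t -> 1 + e <= u t -> d <= k t) ->
  forall x, 0 <= x <= 1 -> u x <= 1.
Proof.
move=> cu cs igs ik ue se s1 gmon g0 gpos gneg kpos x x01.
have [c cI umax] := @EVT_max R u 0 1 ler01 (continuous_subspaceT cu).
move: cI; rewrite in_itv/= => /andP[c0 c1].
have umax' t : 0 <= t <= 1 -> u t <= u c by move=> t01; apply: umax; rewrite in_itv.
have [uc1|uc1] := leP (u c) 1; first exact: le_trans (umax' _ x01) uc1.
exfalso.
pose e := (u c - 1) / 2.
have e0 : 0 < e by rewrite divr_gt0// subr_gt0.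
have [d d0 kd] := kpos _ e0.
have /cvgrPdist_le/(_ _ e0)/nbhs_ballP[del /= del0 Hdel] := cu c.
have kd' t : I01 t -> `|t - c| < del -> d <= k t.
  move=> It tc; apply: kd => //; have := Hdel t; rewrite /ball/= distrC => /(_ tc).
  move=> /(le_trans (ler_norm _)); rewrite /e; lra.
have right : c < 1 -> s c < 0.
  move=> c_lt1; rewrite ltNge; apply/negP => sc.
  pose y2 := Num.min 1 (c + del / 2); pose y1 := (c + y2) / 2.
  have cy2 : c < y2 by rewrite /y2 lt_min c_lt1 ltrDl divr_gt0.
  have y21 : y2 <= 1 by rewrite /y2 ge_min lexx.
  have y2d : y2 <= c + del / 2 by rewrite /y2 ge_min lexx orbT.
  have s_ge t : c <= t <= y2 -> d * (t - c) <= s t.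
    move=> /andP[ct ty2]; apply: (@le_trans _ _ (s t - s c)); last by rewrite gerBl.
    rewrite !se; apply: prim_sub_ge => //; first exact: le_trans y21.
    move=> r Ir /andP[cr rt]; apply: kd' => //.
    by rewrite ger0_norm; lra.
  have u1 : 0 <= u y1 - u c.
    rewrite !ue opprD addrACA subrr add0r -(mul0r (y1 - c)).
    apply: prim_sub_ge => //; rewrite /y1; try lra.
    move=> t It /andP[ct ty]; apply/ltW/gpos; apply: lt_le_trans (s_ge t _); last lra.
    by rewrite mulr_gt0// subr_gt0.
  have eta0 : 0 < d * (y1 - c) by rewrite mulr_gt0// subr_gt0 /y1; lra.
  have u2 : 0 < u y2 - u y1.
    apply: (@lt_le_trans _ _ (g (d * (y1 - c)) * (y2 - y1))).
      by rewrite mulr_gt0 ?gpos// subr_gt0 /y1; lra.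
    rewrite !ue opprD addrACA subrr add0r.
    apply: prim_sub_ge => //; rewrite ?/y1; try lra.
    move=> t It /andP[yt ty]; apply: gmon; apply: le_trans (s_ge t _); last lra.
    by rewrite ler_pM2l//; lra.
  by have := umax' y2; lra.
have left : 0 < c -> 0 < s c.
  move=> c_gt0; rewrite ltNge; apply/negP => sc.
  pose y2 := Num.max 0 (c - del / 2); pose y1 := (c + y2) / 2.
  have cy2 : y2 < c by rewrite /y2 gt_max c_gt0 ltrBlDr ltrDl divr_gt0.
  have y20 : 0 <= y2 by rewrite /y2 le_max lexx.
  have y2d : c - del / 2 <= y2 by rewrite /y2 le_max lexx orbT.
  have s_le t : y2 <= t <= c -> s t <= - (d * (c - t)).
    move=> /andP[y2t tc].
    suff : d * (c - t) <= s c - s t by lra.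
    rewrite !se; apply: prim_sub_ge => //; first exact: le_trans y2t.
    move=> r Ir /andP[cr rt]; apply: kd' => //.
    by rewrite ler0_norm; lra.
  have u1 : u c - u y1 <= 0.
    rewrite !ue opprD addrACA subrr add0r -(mul0r (c - y1)).
    apply: prim_sub_le_cst => //; rewrite /y1; try lra.
    move=> t It /andP[ct ty]; rewrite -g0; apply: gmon.
    apply: le_trans (s_le t _) _; first lra.
    by rewrite oppr_le0 mulr_ge0 ?(ltW d0)// subr_ge0.
  have eta0 : 0 < d * (c - y1) by rewrite mulr_gt0// subr_gt0 /y1; lra.
  have u2 : u y1 - u y2 < 0.
    apply: (@le_lt_trans _ _ (g (- (d * (c - y1))) * (y1 - y2))); last first.
      by rewrite nmulr_rlt0 ?subr_gt0 ?gneg ?oppr_lt0// /y1; lra.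
    rewrite !ue opprD addrACA subrr add0r.
    apply: prim_sub_le_cst => //; rewrite ?/y1; try lra.
    move=> t It /andP[yt ty]; apply: gmon; apply: le_trans (s_le t _) _; first lra.
    by rewrite lerN2 ler_pM2l//; lra.
  by have := umax' y2; lra.
have s0 : s 0 = 0 by rewrite se prim_le0.
have [c0'|c_neq0] := eqVneq c 0; first by have := right; rewrite c0' s0; lra.
have [c1'|c_neq1] := eqVneq c 1; first by have := left; rewrite c1' s1; lra.
have cl1 : c < 1 by rewrite lt_neqAle c_neq1.
have cg0 : 0 < c by rewrite lt_neqAle eq_sym c_neq0.
by have := right cl1; have := left cg0; lra.
Qed.

(** Shooting on the initial value a = u 0, the condition to be met being s 1 = 0. For a = 1
    the quadrant u >= 1, s >= 0 is invariant and s 1 >= 0; for a = 0 the quadrant u <= 0,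
    s <= 0 is invariant and s 1 <= 0; the intermediate value theorem applies because s 1
    depends continuously on a. To keep the right-hand side bounded, u is first clamped in
    the second equation; the maximum principle, for u and for 1 - u, shows that the clamp is
    inactive. *)
Lemma boundary_value_problem (lam B Lg : R) (f g : R -> R) :
  0 < lam -> measurable_fun I01 f -> (forall t, I01 t -> 0 <= f t <= 1) ->
  (forall x y, `|g x - g y| <= Lg * `|x - y|) -> (forall x, `|g x| <= B) ->
  {homo g : x y / x <= y} -> g 0 = 0 -> (forall z : R, 0 < z -> 0 < g z) ->
  (forall z : R, z < 0 -> g z < 0) ->
  exists (a : R) (u s : R -> R), [/\ continuous u, continuous s,
    forall x, u x = a + prim (g \o s) x,
    forall x, s x = prim (fun t => lam * (u t - f t)) x &
    s 1 = 0 /\ forall x, 0 <= x <= 1 -> 0 <= u x <= 1].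
Proof.
move=> lam0 mf f01 gL gB gmon g0 gpos gneg.
(* [0, 1] has to lie in the interior of [-1, 2]: the sign of u - f for u outside [0, 1] must
   survive the clamp, with a margin *)
pose cl := clamp (-1) 2 : R -> R.
have N12 : -1 <= 2 :> R by lra.
have clb z : -1 <= cl z <= 2 by exact: clamp_itv.
pose h b (t z : R) := if b then g z else lam * (cl z - f t).
have cg : continuous g by apply: (@lipschitz_cont _ g Lg) => x y; exact: gL.
have ccl : continuous cl.
  by apply: (@lipschitz_cont _ cl 1) => x y; rewrite mul1r; exact: clamp_lip.
pose L := `|Lg| + lam + 1; pose M := B + lam * 2.
have L0 : 0 < L by rewrite /L ltr_wpDl// addr_ge0// ltW.
have B0 : 0 <= B by apply: le_trans (gB 0).
have M0 : 0 <= M by rewrite /M addr_ge0// mulr_ge0// ltW.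
have mh b z : continuous z -> measurable_fun I01 (fun t => h b t (z t)).
  move=> cz; case: b => /=.
    apply: measurable_funTS; apply: continuous_measurable_fun.
    by move=> t; apply: continuous_comp; [exact: cz|exact: cg].
  apply: measurable_funM => //; apply: measurable_funB => //.
  apply: measurable_funTS; apply: continuous_measurable_fun.
  by move=> t; apply: continuous_comp; [exact: cz|exact: ccl].
have hM b t z : I01 t -> `|h b t z| <= M.
  move=> It; case: b; rewrite /h.
    by apply: (le_trans (gB _)); rewrite /M lerDl mulr_ge0// ltW.
  apply: (@le_trans _ _ (lam * 2)); last by rewrite /M lerDr.
  rewrite normrM (gtr0_norm lam0) ler_pM2l// ler_norml.
  by have := clb z; have := f01 _ It; lra.
have hL b t z z' : I01 t -> `|h b t z - h b t z'| <= L * `|z - z'|.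
  move=> It; case: b; rewrite /h.
    apply: (le_trans (gL _ _)); apply: ler_wpM2r => //.
    by have := ler_norm Lg; rewrite /L; lra.
  have -> : lam * (cl z - f t) - lam * (cl z' - f t) = lam * (cl z - cl z') by ring.
  rewrite normrM (gtr0_norm lam0); apply: (@le_trans _ _ (lam * `|z - z'|)).
    by rewrite ler_pM2l//; exact: clamp_lip.
  by apply: ler_wpM2r => //; rewrite /L; have := normr_ge0 Lg; lra.
pose c (a : R) (b : bool) := if b then a else 0.
pose Z a := picard_lim h (c a).
have Zeq a b x : Z a b x = c a b + prim (fun t => h b t (Z a (~~ b) t)) x.
  exact: (picard_lim_eq L0 M0 mh hM hL).
have Zc a b : continuous (Z a b) by exact: (picard_lim_continuous L0 M0 mh hM hL).
have L1h b z : continuous z -> L1 (fun t => h b t (z t)).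
  by move=> cz; apply: (@L1_bounded _ _ M) => [|t It]; [exact: mh|exact: hM].
have Z1 : 0 <= Z 1 false 1.
  suff H : forall b x, [set z | (if b then 1 else 0) <= z] (Z 1 b x) by exact: (H false 1).
  apply: (@picard_lim_invariant _ L M h L0 M0 mh hM hL (c 1)
    (fun b => [set z | (if b then 1 else 0) <= z])) => [b|b|W cW WP b x].
  - exact: closed_ge.
  - by rewrite /= /c; case: b.
  - rewrite /picard_step /=; have -> : (if b then 1 else 0) = c 1 b by case: b.
    rewrite lerDl; apply: Rintegral_ge0 => t [It _]; rewrite /h; case: b => /=.
      rewrite -g0; apply: gmon; exact: (WP false t).
    rewrite mulr_ge0 ?(ltW lam0)// subr_ge0.
    apply: (@le_trans _ _ 1); first by have := f01 _ It; lra.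
    have := WP true t; rewrite /= => W1; rewrite -(@clamp_id _ (-1) 2 1).
      exact: clamp_le.
    by lra.
have Z0 : Z 0 false 1 <= 0.
  suff H : forall b x, [set z : R | z <= 0] (Z 0 b x) by exact: (H false 1).
  apply: (@picard_lim_invariant _ L M h L0 M0 mh hM hL (c 0)
    (fun=> [set z : R | z <= 0])) => [b|b|W cW WP b x].
  - exact: closed_le.
  - by rewrite /= /c; case: b.
  - rewrite /picard_step /=; have -> : c 0 b = 0 by rewrite /c; case: b.
    rewrite add0r -oppr_ge0.
    have i0 : L1 (fun t => h b t (W (~~ b) t)) by apply: L1h; exact: cW.
    rewrite -mulN1r -primZ//; apply: Rintegral_ge0 => t [It _].
    rewrite mulN1r oppr_ge0 /h; case: b {i0} => /=.
      rewrite -g0; apply: gmon; exact: (WP false t).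
    rewrite pmulr_rle0// subr_le0.
    apply: (@le_trans _ _ 0); last by have := f01 _ It; lra.
    have := WP true t; rewrite /= => W1; rewrite -(@clamp_id _ (-1) 2 0).
      exact: clamp_le.
    by lra.
have Zlip : continuous (fun a => Z a false 1).
  apply: (@lipschitz_cont _ _ (2 * expR (2 * L))) => a a'.
  have H b : `|c a' b - c a b| <= `|a' - a|.
    by case: b; rewrite /c// subrr normr0.
  have := picard_lim_dep L0 M0 mh hM hL H false 1.
  by rewrite normr1 mulr1 mulrAC.
have [a _ Za] : exists2 a, a \in `[0, 1]%R & Z a false 1 = 0.
  apply: (@IVT R (fun a => Z a false 1)) => //; first exact: continuous_subspaceT.
  by rewrite ge_min Z0/= le_max Z1 orbT.
pose u : R -> R := Z a true; pose s : R -> R := Z a false.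
pose k t := h false t (u t).
have ue x : u x = a + prim (g \o s) x by exact: Zeq.
have se x : s x = prim k x by rewrite /s Zeq /= add0r.
have igs : L1 (g \o s) by apply: (L1h true); exact: Zc.
have ik : L1 k by apply: (L1h false); exact: Zc.
have u_le1 x : 0 <= x <= 1 -> u x <= 1.
  apply: (@maximum_principle a u s k g) => //; [exact: Zc..|].
  move=> e e0; exists (lam * Num.min e 1) => [|t It ut].
    by rewrite mulr_gt0// lt_min e0 ltr01.
  rewrite /k /h ler_pM2l//; have := f01 _ It.
  have : cl (1 + Num.min e 1) <= cl (u t).
    apply: clamp_le; apply: le_trans ut; rewrite lerD2l ge_min lexx//.
  have e1 : Num.min e 1 <= 1 by rewrite ge_min lexx orbT.
  have e10 : 0 < Num.min e 1 by rewrite lt_min e0 ltr01.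
  by rewrite {1}/cl clamp_id; lra.
have u_ge0 x : 0 <= x <= 1 -> 0 <= u x.
  move=> x01; rewrite -subr_le0 sub0r -(lerD2l 1) addr0.
  apply: (@maximum_principle (1 - a) (fun x => 1 - u x) (fun x => - s x)
    (fun t => -1 * k t) (fun z => - g (- z))) x01.
  - by move=> t; apply: cvgB; [exact: cvg_cst|exact: Zc].
  - by move=> t; apply: cvgN; exact: Zc.
  - apply: eq_integrable (L1Z (-1) igs) => // t _ /=.
    by rewrite opprK mulN1r.
  - exact: L1Z.
  - move=> t; rewrite ue; have -> : prim ((fun z => - g (- z)) \o (fun x => - s x)) t
      = prim (fun r => -1 * (g \o s) r) t.
      by apply: eq_prim => r _ /=; rewrite opprK mulN1r.
    by rewrite primZ// mulN1r opprD addrA.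
  - by move=> t; rewrite primZ// mulN1r se.
  - by rewrite /s Za oppr0.
  - by move=> y z yz; rewrite lerN2; apply: gmon; rewrite lerN2.
  - by rewrite oppr0 g0 oppr0.
  - by move=> z z0; rewrite oppr_gt0; apply: gneg; rewrite oppr_lt0.
  - by move=> z z0; rewrite oppr_lt0; apply: gpos; rewrite oppr_gt0.
  - move=> e e0; exists (lam * Num.min e 1) => [|t It ut].
      by rewrite mulr_gt0// lt_min e0 ltr01.
    rewrite /k /h mulN1r -mulrN ler_pM2l//; have := f01 _ It.
    have e1 : Num.min e 1 <= 1 by rewrite ge_min lexx orbT.
    have e10 : 0 < Num.min e 1 by rewrite lt_min e0 ltr01.
    have : cl (u t) <= cl (- Num.min e 1).
      by have me : Num.min e 1 <= e; [rewrite ge_min lexx|apply: clamp_le; lra].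
    by rewrite {2}/cl clamp_id; lra.
exists a, u, s; split => //; try exact: Zc.
  move=> x; rewrite se; apply: eq_prim => t; rewrite /= in_itv/= => /andP[t0 t1].
  have t01 : 0 <= t <= 1 by rewrite !ltW.
  by rewrite /k /h /cl clamp_id//; have := u_le1 _ t01; have := u_ge0 _ t01; lra.
by split=> // x x01; rewrite u_le1// u_ge0.
Qed.
End shooting.

(** * Solutions of the Euler equation *)
Section regularity.
Context {R : realType}.
Local Notation mu := (@lebesgue_measure R).
Local Notation I01 := (`]0%R, 1%R[%classic : set R).
Variables (F : R -> R) (nu1 : R).
Hypotheses (F1 : condF1 F) (F2 : condF2 nu1 F) (F4 : condF4 F).
Local Notation F' := (derive1 F).
Local Notation F'' := (derive1 (derive1 F)).

Lemma is_derive_F (p : R) : is_derive p 1 F (F' p).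
Proof. by have [dF _ _ _ _] := F1; rewrite derive1E; exact: derivableP. Qed.

Lemma is_derive_F' (p : R) : is_derive p 1 F' (F'' p).
Proof. by have [_ dF _ _ _] := F1; rewrite [F'' p]derive1E; exact: derivableP. Qed.

Lemma continuous_F' : continuous F'.
Proof.
have [_ dF _ _ _] := F1.
by move=> p; apply: differentiable_continuous; apply/derivable1_diffP; exact: dF.
Qed.

Lemma continuous_F : continuous F.
Proof.
move=> x; have [dF _ _ _ _] := F1.
by apply: differentiable_continuous; apply/derivable1_diffP; exact: dF.
Qed.

Lemma F'_odd (p : R) : F' (- p) = - F' p.
Proof.
have [_ _ _ Fe _] := F1.
have H : is_derive p 1 F (- F' (- p)).
  rewrite [X in is_derive _ _ X _](_ : F = F \o -%R); last by apply/funext => x /=; rewrite Fe.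
  have dF := is_derive_F (- p).
  have dN : is_derive p 1 (-%R : R -> R) (- 1) by exact: is_deriveN.
  have := is_derive1_comp dF dN.
  by rewrite mulrN1.
by have [_ E] := H; have [_ E'] := is_derive_F p; rewrite -E' E opprK.
Qed.

Lemma F'0 : F' 0 = 0.
Proof. by have := F'_odd 0; rewrite oppr0; lra. Qed.

Lemma between_dist (p q c : R) : Num.min p q <= c <= Num.max p q ->
  `|p - c| <= `|p - q|.
Proof.
case/orP: (le_total p q) => pq.
  by rewrite (min_idPl pq) (max_idPr pq) => /andP[? ?]; rewrite !ler0_norm; lra.
by rewrite (min_idPr pq) (max_idPl pq) => /andP[? ?]; rewrite !ger0_norm; lra.
Qed.

Lemma F'_MVT (p q : R) : exists c,
  [/\ Num.min p q <= c <= Num.max p q & F' q - F' p = F'' c * (q - p)].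
Proof.
wlog pq : p q / p <= q.
  move=> H; case/orP: (le_total p q) => [pq|qp]; first exact: H.
  have [c [cpq E]] := H _ _ qp; exists c; rewrite minC maxC.
  by split=> //; rewrite -(opprB (F' p)) E -mulrN opprB.
rewrite (min_idPl pq) (max_idPr pq).
move: pq; rewrite le_eqVlt => /predU1P[->|pq].
  by exists q; rewrite !subrr mulr0 lexx.
have [c] := MVT pq (fun x _ => is_derive_F' x) (continuous_subspaceT continuous_F').
by rewrite in_itv/= => /andP[pc cq] E; exists c; rewrite !ltW.
Qed.

Lemma F'_lt (p q : R) : p < q -> F' p < F' q.
Proof.
move=> pq; have [c [_ E]] := F'_MVT p q.
by rewrite -subr_gt0 E mulr_gt0 ?subr_gt0//; exact: F4.
Qed.

Lemma F'_le (p q : R) : (F' p <= F' q) = (p <= q).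
Proof.
have [pq|qp] := leP p q; last by apply/negbTE; rewrite -ltNge; exact: F'_lt.
by move: pq; rewrite le_eqVlt => /predU1P[->|pq]; [exact: lexx|exact/ltW/F'_lt].
Qed.

Lemma F'_exceeds (lam : R) : lam < lambda_infty F -> exists P, lam < F' P.
Proof.
move=> lamF; apply: contrapT => H.
have HF p : F' p <= lam by rewrite leNgt; apply/negP => Hp; apply: H; exists p.
have cF : cvg (F' p @[p --> +oo]).
  apply: cvgP; apply: nondecreasing_cvgr; first by move=> x y xy; rewrite F'_le.
  by exists lam => _ [p _ <-].
suff : lambda_infty F <= lam by lra.
by apply: limr_le => //; exact: nearW.
Qed.

(** Some P has F' P > lam, and F' maps [- P, P] onto an interval that contains [- lam, lam].
    The inverse of F', frozen outside [- lam, lam] at its end values, takes its values in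
    [- P, P], where F'' has a positive minimum; this makes it Lipschitz. *)
Lemma truncated_inverse (lam : R) : 0 < lam -> lam < lambda_infty F ->
  exists (g : R -> R) (B Lg : R),
  [/\ (forall x y, `|g x - g y| <= Lg * `|x - y|) /\ (forall x, `|g x| <= B),
    {homo g : x y / x <= y}, g 0 = 0,
    (forall z : R, 0 < z -> 0 < g z) /\ (forall z : R, z < 0 -> g z < 0) &
    forall z : R, `|z| <= lam -> F' (g z) = z].
Proof.
move=> lam0 lamF; have [P lamP] := F'_exceeds lamF.
have P0 : 0 < P.
  by rewrite ltNge -F'_le F'0 -ltNge; exact: lt_trans lamP.
have NPP : - P <= P by lra.
have lamN : - lam <= lam by lra.
pose c := clamp (- lam) lam.
have g_ex s : exists p, - P <= p <= P /\ F' p = c s.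
  have := @IVT R F' (- P) P (c s) NPP (continuous_subspaceT continuous_F').
  have /andP[c1 c2] : - lam <= c s <= lam by exact: clamp_itv.
  case; last by move=> p; rewrite in_itv/= => pP Ep; exists p.
  have FNP : F' (- P) <= F' P by rewrite F'_le.
  by rewrite (min_idPl FNP) (max_idPr FNP) F'_odd; lra.
pose g s := sval (cid (g_ex s)).
have gP s : - P <= g s <= P by rewrite /g; case: cid => p [].
have gE s : F' (g s) = c s by rewrite /g; case: cid => p [].
have [_ _ cF'' _ _] := F1.
have [p0 _ p0min] := EVT_min NPP (continuous_subspaceT cF'').
exists g, P, (F'' p0)^-1; split.
- split=> [x y|x]; last by rewrite ler_norml.
  rewrite mulrC ler_pdivlMr ?F4//.
  have [d [dxy E]] := F'_MVT (g y) (g x).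
  apply: le_trans (clamp_lip (- lam) lam x y); rewrite -/c -!gE E normrM mulrC.
  rewrite ler_wpM2r//; apply: le_trans (ler_norm _); apply: p0min.
  have := gP x; have := gP y; rewrite in_itv/=; move: dxy.
  by rewrite ge_min le_max => /andP[/orP[] ? /orP[]]; lra.
- by move=> x y xy; rewrite -F'_le !gE; exact: clamp_le.
- have E : F' (g 0) = F' 0 by rewrite gE F'0 /c clamp_id//; lra.
  by apply/eqP; rewrite eq_le -(F'_le (g 0)) -(F'_le 0) E lexx.
- have c0 : c 0 = 0 by rewrite /c clamp_id//; lra.
  split=> z z0; rewrite ltNge -F'_le gE F'0 -ltNge; rewrite /c /clamp.
    by rewrite lt_max lt_min z0 lam0 orbT.
  by rewrite gt_max gt_min z0 orbT oppr_lt0 lam0.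
- by move=> z zl; rewrite gE /c clamp_id// -ler_norml.
Qed.

Lemma prim_sub_le_near h (x e d : R) : L1 h -> 0 <= x <= 1 ->
  (forall t, I01 t -> `|t - x| < d -> `|h t| <= e) ->
  forall y, 0 <= y <= 1 -> `|y - x| < d ->
    `|prim h y - prim h x| <= e * `|y - x|.
Proof.
move=> ih /andP[x0 x1] hx y /andP[y0 y1] yxd; have [xy|/ltW yx] := leP x y.
  rewrite (@ger0_norm _ (y - x)) ?subr_ge0//.
  have := @prim_sub_approx _ h x y 0 e ih x0 xy y1; rewrite mul0r subr0; apply.
  move=> t It /andP[xt ty]; rewrite subr0; apply: hx => //; apply: le_lt_trans yxd.
  by rewrite !ger0_norm; lra.
rewrite distrC (distrC y) (@ger0_norm _ (x - y)) ?subr_ge0//.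
have := @prim_sub_approx _ h y x 0 e ih y0 yx x1; rewrite mul0r subr0; apply.
move=> t It /andP[xt ty]; rewrite subr0; apply: hx => //; apply: le_lt_trans yxd.
by rewrite !ler0_norm; lra.
Qed.

Lemma inv_F''_continuous (p : R) : continuous_at p (fun p => (F'' p)^-1).
Proof.
have [_ _ cF'' _ _] := F1.
by apply: cvgV; [rewrite gt_eqF|exact: cF''].
Qed.

Lemma div_F''_bounded (k q : R -> R) (M : R) : measurable_fun I01 k ->
  (forall t, I01 t -> `|k t| <= M) -> continuous q ->
  measurable_fun I01 (fun t => k t / F'' (q t)) /\
  exists B, forall t, I01 t -> `|k t / F'' (q t)| <= B.
Proof.
move=> mk kM cq.
have cIq : continuous (fun t => (F'' (q t))^-1).
  move=> t; apply: (@continuous_comp _ _ _ q (fun p => (F'' p)^-1)); first exact: cq.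
  exact: inv_F''_continuous.
split.
  apply: measurable_funM => //.
  by apply: measurable_funTS; exact: continuous_measurable_fun.
have [t0 _ Ht0] := EVT_max ler01 (continuous_subspaceT cIq).
exists (M * (F'' (q t0))^-1) => t It; rewrite normrM.
apply: ler_pM => //; first exact: kM.
rewrite ger0_norm ?invr_ge0; last exact/ltW/F4.
by apply: Ht0; move: It; rewrite /= !in_itv/= => /andP[/ltW -> /ltW ->].
Qed.

(** The chain rule for the inverse of F' composed with s, in integrated form: as k is only
    bounded and measurable, s need not be differentiable. Near x, both q and the primitive of
    k / F'' q increase like (s y - s x) / F'' (q x) up to a small multiple of y - x, hence
    their difference is flat. *)
Lemma prim_inverse (k q s : R -> R) (M : R) : measurable_fun I01 k -> 0 < M ->
  (forall t, I01 t -> `|k t| <= M) -> continuous q ->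
  (forall x, s x = prim k x) -> (forall x, F' (q x) = s x) ->
  forall x, 0 <= x <= 1 -> q x = q 0 + prim (fun t => k t / F'' (q t)) x.
Proof.
move=> mk M0 kM cq se qs.
have ik : L1 k by exact: L1_bounded kM.
have [mh [C hC]] := div_F''_bounded mk kM cq.
have ih : L1 (fun t => k t / F'' (q t)) by exact: L1_bounded hC.
move=> x x01.
suff : q x - prim (fun t => k t / F'' (q t)) x = q 0 - prim (fun t => k t / F'' (q t)) 0.
  by rewrite (@prim_le0 _ _ 0)// subr0 => <-; rewrite subrK.
pose D y := q y - prim (fun t => k t / F'' (q t)) y.
apply: (@constant_of_flat _ D) x01 => {}x x01 e e0.
pose e' := e / (2 * M).
have e'0 : 0 < e' by rewrite divr_gt0// mulr_gt0.
have /cvgrPdist_le/(_ _ e'0)/nbhs_ballP[eta /= eta0 Heta] := @inv_F''_continuous (q x).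
have /cvgrPdist_lt/(_ _ eta0)/nbhs_ballP[d /= d0 Hd] := cq x.
exists d => // y y01 yxd.
have qyx : `|q x - q y| < eta by apply: Hd; rewrite /ball/= distrC.
pose r : R := (F'' (q x))^-1.
have A : `|q y - q x - r * (s y - s x)| <= e / 2 * `|y - x|.
  have [c [cxy E]] := F'_MVT (q x) (q y).
  have cq_x : `|q x - c| < eta.
    apply: le_lt_trans qyx; exact: between_dist.
  have Ec := Heta _ cq_x.
  have -> : q y - q x = (F'' c)^-1 * (s y - s x).
    by rewrite -!qs E mulKf// gt_eqF.
  rewrite -mulrBl normrM.
  apply: (@le_trans _ _ (e' * (M * `|y - x|))).
    apply: ler_pM; [exact: normr_ge0|exact: normr_ge0|by rewrite distrC; exact: Ec|].
    by rewrite !se; apply: prim_sub_le => //; exact: ltW.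
  rewrite mulrA ler_wpM2r// /e' le_eqVlt; apply/orP; left; apply/eqP.
  by field; rewrite gt_eqF.
have B : `|prim (fun t => k t / F'' (q t)) y - prim (fun t => k t / F'' (q t)) x
   - r * (s y - s x)| <= e / 2 * `|y - x|.
  have irk : L1 (fun t => r * k t) by exact: L1Z.
  have -> : prim (fun t => k t / F'' (q t)) y - prim (fun t => k t / F'' (q t)) x
     - r * (s y - s x) = prim (fun t => k t / F'' (q t) - r * k t) y
     - prim (fun t => k t / F'' (q t) - r * k t) x.
    by rewrite !primB// !primZ// -!se; ring.
  apply: (@prim_sub_le_near _ x (e / 2) d) => //; first exact: L1B.
  move=> t It txd; rewrite (mulrC r) -mulrBr normrM.
  have Et : `|q x - q t| < eta by apply: Hd; rewrite /ball/= distrC.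
  apply: (@le_trans _ _ (M * e')).
    apply: ler_pM; [exact: normr_ge0|exact: normr_ge0|exact: kM|].
    by rewrite distrC; exact: (Heta _ Et).
  by rewrite /e' le_eqVlt; apply/orP; left; apply/eqP; field; rewrite gt_eqF.
have -> : D y - D x = (q y - q x - r * (s y - s x)) -
  (prim (fun t => k t / F'' (q t)) y - prim (fun t => k t / F'' (q t)) x
   - r * (s y - s x)) by rewrite /D; ring.
apply: (le_trans (ler_normB _ _)).
have -> : e * `|y - x| = e / 2 * `|y - x| + e / 2 * `|y - x| by rewrite -mulrDl -splitr.
exact: lerD.
Qed.

(** The truncation of the inverse of F' is not seen by the solution: |u - f| <= 1 gives
    |s| <= lam, the range on which F' (g z) = z. *)
Lemma regular_solution (f : R -> R) (lam : R) : 0 < lam -> lam < lambda_infty F ->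
  measurable_fun I01 f -> (forall t, I01 t -> 0 <= f t <= 1) ->
  exists (a : R) (u q s : R -> R),
  [/\ [/\ continuous u, continuous q & continuous s],
    [/\ (forall x, u x = a + prim q x),
        (forall x, s x = prim (fun t => lam * (u t - f t)) x) &
        (forall x, 0 <= x <= 1 -> q x = prim (fun t => lam * (u t - f t) / F'' (q t)) x)],
    [/\ s 1 = 0, q 0 = 0 & q 1 = 0],
    (forall x, 0 <= x <= 1 -> 0 <= u x <= 1) &
    (forall x, `|s x| <= lam) /\ (forall x, F' (q x) = s x)].
Proof.
move=> lam0 lamF mf f01.
have [g [B [Lg [[gL gB] gmon g0 [gpos gneg] gE]]]] := truncated_inverse lam0 lamF.
have [a [u [s [cu cs ue se [s1 u01]]]]] :=
  boundary_value_problem lam0 mf f01 gL gB gmon g0 gpos gneg.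
have cg : continuous g by apply: (@lipschitz_cont _ g Lg) => x y; exact: gL.
have cq : continuous (g \o s).
  by move=> t; apply: continuous_comp; [exact: cs|exact: cg].
have mk : measurable_fun I01 (fun t => lam * (u t - f t)).
  apply: measurable_funM => //; apply: measurable_funB => //.
  by apply: measurable_funTS; exact: continuous_measurable_fun.
have kM t : I01 t -> `|lam * (u t - f t)| <= lam.
  move=> It; rewrite normrM (gtr0_norm lam0) ger_pMr// ler_norml.
  have := f01 _ It; move: It; rewrite /= in_itv/= => /andP[t0 t1].
  by have := u01 t; rewrite (ltW t0) (ltW t1) => /(_ isT); lra.
have ik : L1 (fun t => lam * (u t - f t)) by exact: L1_bounded kM.
have s_le x : `|s x| <= lam.
  have H y : 0 <= y <= 1 -> `|s y| <= lam.
    move=> /andP[y0 y1]; rewrite -[s y]subr0 -[X in _ - X](@prim_le0 _ (fun t => lam * (u t - f t)) 0)// se.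
    apply: (le_trans (prim_sub_le _ _ ik (ltW lam0) kM)).
    by rewrite subr0 ger0_norm// ger_pMr.
  have [x0|/ltW x0] := leP x 0; first by rewrite se prim_le0// normr0 ltW.
  have [x1|/ltW x1] := leP x 1; first by rewrite H// x0.
  by rewrite se prim_ge1// -(@prim_ge1 _ _ 1)// -se H// ler01 lexx.
have qs x : F' ((g \o s) x) = s x by rewrite /= gE.
have s0 : s 0 = 0 by rewrite se prim_le0.
exists a, u, (g \o s), s; split => //.
  split=> // x x01.
  rewrite (@prim_inverse _ _ _ lam mk lam0 kM cq se qs x x01).
  by rewrite /= s0 g0 add0r.
by rewrite /= s1 s0 g0.
Qed.

Lemma F_above_tangent (p r : R) : F p + F' p * (r - p) <= F r.
Proof.
have [pr|rp|->] := ltgtP p r; last by rewrite subrr mulr0 addr0.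
  have [c] := MVT pr (fun x _ => is_derive_F x) (continuous_subspaceT continuous_F).
  rewrite in_itv/= => /andP[pc cr] E; rewrite addrC -lerBrDr E.
  by apply: ler_wpM2r; [rewrite subr_ge0 ltW|rewrite F'_le ltW].
have [c] := MVT rp (fun x _ => is_derive_F x) (continuous_subspaceT continuous_F).
rewrite in_itv/= => /andP[rc cp] E.
have : F' c * (p - r) <= F' p * (p - r).
  by apply: ler_wpM2r; [rewrite subr_ge0 ltW|rewrite F'_le ltW].
rewrite -E -(opprB p r) mulrN; lra.
Qed.

Lemma F_le_norm (p : R) : F p <= nu1 * `|p|.
Proof.
have [_ _ _ _ F0] := F1.
have := F_above_tangent p 0; rewrite F0 sub0r mulrN subr_le0 => Fp.
apply: (le_trans Fp); apply: (le_trans (ler_norm _)).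
by rewrite normrM ler_wpM2r.
Qed.

End regularity.

(** * Test functions *)
Section test_functions.
Context {R : realType}.
Local Notation mu := (@lebesgue_measure R).
Local Notation I01 := (`]0%R, 1%R[%classic : set R).
Implicit Types (phi psi f g : R -> R) (x y : R).

Definition smooth f := forall n (x : R), derivable (f^`(n)) x 1.

Lemma derive1_eq f (df : R -> R) : (forall x : R, is_derive x 1 f (df x)) -> f^`() = df.
Proof. by move=> H; apply/funext => x; rewrite derive1E; have [_ ->] := H x. Qed.

(** Membership in a class stable under differentiation passes to all iterated derivatives,
    which therefore never have to be computed. *)
Lemma smooth_of_class (C : set (R -> R)) :
  (forall f, C f -> exists2 df, C df & forall x : R, is_derive x 1 f (df x)) ->
  forall f, C f -> smooth f.
Proof.
move=> HC f Cf.
have Cn n : C f^`(n).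
  elim: n => [//|n /HC[df Cdf H]].
  by rewrite derive1nS (derive1_eq H).
by move=> n x; have [df _ H] := HC _ (Cn n); have [] := H x.
Qed.

Lemma smooth_is_derive f : smooth f -> forall x : R, is_derive x 1 f (derive1 f x).
Proof. by move=> sf x; rewrite derive1E; apply: derivableP; exact: (sf 0%N). Qed.

Lemma smooth_derive1 f : smooth f -> smooth f^`().
Proof. by move=> sf n x; rewrite -derive1Sn; exact: sf. Qed.

Lemma smooth_continuous f : smooth f -> continuous f.
Proof.
move=> sf x; apply: differentiable_continuous; apply/derivable1_diffP; exact: (sf 0%N).
Qed.

Lemma smooth_lin f g (c : R) : smooth f -> smooth g -> smooth (fun x => f x + c * g x).
Proof.
move=> sf sg.
apply: (@smooth_of_class [set k | exists f g, [/\ smooth f, smooth g &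
  k = fun x => f x + c * g x]]); last by exists f, g.
move=> _ [{sf sg}f [{}g [sf sg ->]]].
exists (fun x => derive1 f x + c * derive1 g x).
  by exists (derive1 f), (derive1 g); split; [exact: smooth_derive1|exact: smooth_derive1|].
move=> x; apply: is_deriveD; first exact: smooth_is_derive.
have := @is_deriveZ _ _ _ g c x 1 _ (smooth_is_derive sg x).
by [].
Qed.

Let bump_algebra (c p0 p1 w W1 E : R) (k : nat) : w != 0 ->
  p0 * w^-1 ^+ k * (E * (- c * (- w ^- 2 * W1))) +
  E * (p0 * (k%:R * w^-1 ^+ k.-1 * (- w ^- 2 * W1)) + w^-1 ^+ k * p1) =
  (p1 * w ^+ 2 - k%:R * p0 * W1 * w + c * p0 * W1) * w^-1 ^+ k.+2 * E.
Proof.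
move=> w0; case: k => [|k] /=; first by rewrite !expr0 !exprS expr0; field.
by rewrite !exprS; move: (w^-1 ^+ k) => wk; field.
Qed.

Section bump.
Variables (a b c : R).
Hypotheses (ab : a < b) (c0 : 0 < c).

Let W : {poly R} := ('X - a%:P) * (b%:P - 'X).

Let WE x : W.[x] = (x - a) * (b - x).
Proof. by rewrite /W !hornerE. Qed.

(** With W = (x - a) (b - x), the derivatives of exp (- c / W) are of the form
    p W^-k exp (- c / W) with p a polynomial, and this family is stable under
    differentiation. The parameter c is kept because exp (- c / W) tends to 1 on (a, b) as c
    tends to 0. *)
Definition bump_poly (p : {poly R}) (k : nat) (x : R) : R :=
  if a < x < b then p.[x] * W.[x]^-1 ^+ k * expR (- c * W.[x]^-1) else 0.

Definition smooth_bump := bump_poly 1 0.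

Let dbump p k := p^`() * W ^+ 2 - (k%:R)%:P * p * W^`() * W + c%:P * p * W^`().

Let dbumpE p k x : (dbump p k).[x] = p^`().[x] * W.[x] ^+ 2
  - k%:R * p.[x] * W^`().[x] * W.[x] + c * p.[x] * W^`().[x].
Proof. by rewrite /dbump; generalize W => w; rewrite !hornerE. Qed.

Let W_gt0 x : a < x < b -> 0 < W.[x].
Proof. by move=> /andP[ax xb]; rewrite WE mulr_gt0 ?subr_gt0. Qed.

Let bump_poly_in p k x : a < x < b -> is_derive x 1 (bump_poly p k)
   (bump_poly (dbump p k) k.+2 x).
Proof.
move=> xab; have Wx := W_gt0 xab; have Wx0 : W.[x] != 0 by rewrite gt_eqF.
pose G y : R := p.[y] * W.[y]^-1 ^+ k * expR (- c * W.[y]^-1).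
have dG : is_derive x 1 G (bump_poly (dbump p k) k.+2 x).
  have dp := is_derive_poly p x; have dW := is_derive_poly W x.
  have dV : is_derive x 1 (fun y => W.[y]^-1) (- (W.[x] ^- 2) *: W^`().[x]).
    exact: is_deriveV.
  have dVk : is_derive x 1 (fun y => W.[y]^-1 ^+ k)
     ((k%:R * W.[x]^-1 ^+ k.-1) *: (- (W.[x] ^- 2) *: W^`().[x])).
    have := @is_deriveX _ _ _ k x 1 _ dV.
    by rewrite exprfctE.
  have dE : is_derive x 1 (fun y => expR (- c * W.[y]^-1))
     (expR (- c * W.[x]^-1) * (- c *: (- (W.[x] ^- 2) *: W^`().[x]))).
    have dcV : is_derive x 1 (fun y => - c * W.[y]^-1) (- c *: (- (W.[x] ^- 2) *: W^`().[x])).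
      exact: (@is_deriveZ _ _ _ (fun y => W.[y]^-1) (- c) x 1 _ dV).
    exact: (@is_derive1_comp _ expR (fun y => - c * W.[y]^-1) x _ _ (is_derive_expR _) dcV).
  have := @is_deriveM _ _ _ _ _ _ _ _ (@is_deriveM _ _ _ _ _ _ _ _ dp dVk) dE.
  move=> H; apply: (is_derive_eq (H : is_derive x 1 G _)).
  rewrite {H} /bump_poly xab dbumpE.
  rewrite -[(horner p * _) x]/(p.[x] * W.[x]^-1 ^+ k) /GRing.scale /=.
  move: (expR (- c / W.[x])) => E.
  move: (p^`().[x]) (W^`().[x]) (p.[x]) (W.[x]) Wx0 => p1 W1 p0 w w0.
  exact: bump_algebra.
have /andP[ax xb] := xab.
apply: is_derive_approx => e e0; have [d d0 Hd] := is_derive_approxE dG e0.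
exists (Num.min d (Num.min (x - a) (b - x))); first by rewrite !lt_min d0 !subr_gt0 ax.
move=> y; rewrite !lt_min => /and3P[yd ya yb].
have yab : a < y < b.
  by move: ya yb; rewrite !ltr_norml => /andP[? ?] /andP[? ?]; apply/andP; split; lra.
have E z : a < z < b -> bump_poly p k z = G z by rewrite /bump_poly => ->.
by rewrite (E _ yab) (E _ xab); exact: Hd.
Qed.

Let W_le x y : ~~ (a < x < b) -> a < y < b -> W.[y] <= (b - a) * `|y - x|.
Proof.
rewrite negb_and -!leNgt => /orP[xa|bx] /andP[ay yb]; rewrite WE.
  by rewrite ger0_norm ?subr_ge0; [nra|lra].
by rewrite ler0_norm ?subr_le0; [nra|lra].
Qed.

(* exp(-c/w) vanishes faster than any power of w *)
Let exp_le k (w : R) : 0 < w ->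
  w^-1 ^+ k * expR (- c * w^-1) <= (k.+2)`!%:R / c ^+ k.+2 * w ^+ 2.
Proof.
move=> w0.
have cw0 : 0 <= c * w^-1 by rewrite mulr_ge0 ?invr_ge0// ltW.
have E := expR_ge1Dxn k.+1 cw0.
have f0 : 0 < (k.+2)`!%:R :> R by rewrite ltr0n fact_gt0.
have X0 : 0 < expR (c * w^-1) by exact: expR_gt0.
have {}E : (c * w^-1) ^+ k.+2 / (k.+2)`!%:R <= expR (c * w^-1) by lra.
rewrite mulNr expRN ler_pdivrMr//.
apply: (@le_trans _ _ ((k.+2)`!%:R / c ^+ k.+2 * w ^+ 2 * ((c * w^-1) ^+ k.+2 / (k.+2)`!%:R))); last first.
  by rewrite ler_wpM2l// mulr_ge0 ?sqr_ge0 ?divr_ge0 ?exprn_ge0// ltW.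
rewrite exprMn -[in X in _ <= X](addn2 k) [in X in _ <= _ * (_ * X / _)]exprD.
rewrite le_eqVlt; apply/orP; left; apply/eqP.
have wn0 : w != 0 by rewrite gt_eqF.
have cn0 : c != 0 by rewrite gt_eqF.
have ckn0 : c ^+ (k + 2) != 0 by rewrite expf_neq0.
move: (w^-1 ^+ k) (c ^+ (k + 2)) ckn0 => wk ck ck0.
have fn0 : (k + 2)`!%:R != 0 :> R by rewrite addn2 gt_eqF.
field.
by rewrite fn0 ck0 wn0.
Qed.

(** At the edges of its support the function is bounded by a multiple of the square of the
    distance. *)
Let bump_poly_out p k x : ~~ (a < x < b) -> is_derive x 1 (bump_poly p k) 0.
Proof.
move=> xab.
have [Mp Mp0 HMp] : exists2 Mp : R, 0 <= Mp & forall y, a < y < b -> `|p.[y]| <= Mp.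
  have cp : continuous (fun y => `|p.[y]|).
    by move=> y; apply: cvg_norm; exact: continuous_horner.
  have [y0 _ Hy0] := EVT_max (ltW ab) (continuous_subspaceT cp).
  exists `|p.[y0]| => // y /andP[ay yb]; apply: Hy0.
  by rewrite in_itv/= !ltW.
pose M : R := Mp * ((k.+2)`!%:R / c ^+ k.+2 * (b - a) ^+ 2).
have M0 : 0 <= M.
  by rewrite mulr_ge0// mulr_ge0 ?sqr_ge0// divr_ge0// exprn_ge0// ltW.
have H y : `|bump_poly p k y| <= M * `|y - x| ^+ 2.
  rewrite {1}/bump_poly; case: ifPn => yab; last first.
    by rewrite normr0 mulr_ge0// sqr_ge0.
  have Wy := W_gt0 yab.
  rewrite -mulrA normrM /M -mulrA; apply: ler_pM => //; first exact: HMp.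
  rewrite ger0_norm; last first.
    by rewrite mulr_ge0 ?expR_ge0// exprn_ge0// invr_ge0 ltW.
  apply: (le_trans (exp_le k Wy)); rewrite -[leRHS]mulrA -exprMn ler_wpM2l//.
    by rewrite divr_ge0// exprn_ge0// ltW.
  apply: lerXn2r; rewrite ?nnegrE; [exact: ltW| |exact: W_le].
  by rewrite mulr_ge0// subr_ge0 ltW.
have fx : bump_poly p k x = 0 by rewrite /bump_poly (negbTE xab).
apply: is_derive_approx => e e0; exists (e / (M + 1)).
  by rewrite divr_gt0// ltr_wpDl.
move=> y yx; rewrite fx subr0 mul0r subr0; apply: (le_trans (H y)).
rewrite expr2 mulrA ler_wpM2r//.
apply: (@le_trans _ _ ((M + 1) * `|y - x|)).
  by rewrite ler_wpM2r// lerDl.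
by rewrite -ler_pdivlMl ?ltr_wpDl// mulrC ltW.
Qed.

Lemma bump_smooth : smooth smooth_bump.
Proof.
apply: (@smooth_of_class [set f | exists p k, f = bump_poly p k]); last by exists 1, 0%N.
move=> _ [p [k ->]]; exists (bump_poly (dbump p k) k.+2); first by exists (dbump p k), k.+2.
move=> x; have [xab|xab] := boolP (a < x < b); first exact: bump_poly_in.
by rewrite {2}/bump_poly (negbTE xab); exact: bump_poly_out.
Qed.

Lemma bumpE x : smooth_bump x = if a < x < b then expR (- c / ((x - a) * (b - x))) else 0.
Proof. by rewrite /smooth_bump /bump_poly hornerC expr0 !mul1r WE. Qed.

Lemma bump_ge0 x : 0 <= smooth_bump x.
Proof. by rewrite bumpE; case: ifPn => // _; exact: expR_ge0. Qed.

Lemma bump_le1 x : smooth_bump x <= 1.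
Proof.
rewrite bumpE; case: ifPn => // xab; rewrite -expR0 ler_expR mulNr oppr_le0.
by rewrite -WE divr_ge0// ltW// W_gt0.
Qed.

End bump.

Lemma test_of_support phi (c d : R) : smooth phi -> 0 < c -> d < 1 ->
  (forall x, ~~ (c <= x <= d) -> phi x = 0) -> test_function phi.
Proof.
move=> sphi c0 d1 phi0.
have sub : closure [set x | phi x != 0] `<=` `[c, d].
  apply: (subset_trans (@closure_subset _ _ `[c, d]%classic _)).
    move=> x /=; apply: contra_neqP => /negP; rewrite in_itv/= => H; exact: phi0.
  have cE : closed (`[c, d]%classic : set R) by exact: interval_closed.
  by rewrite -((closure_id _).1 cE).
split => //.
  apply: subclosed_compact sub; first exact: closed_closure.
  exact: segment_compact.
by move=> x /sub/=; rewrite !in_itv/= => /andP[? ?]; apply/andP; split; lra.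
Qed.

Lemma bump_test (a b c : R) : 0 < a -> a < b -> b < 1 -> 0 < c ->
  test_function (smooth_bump a b c).
Proof.
move=> a0 ab b1 c0; apply: (@test_of_support _ a b) => //; first exact: bump_smooth.
move=> x xab; rewrite bumpE; case: ifPn => // /andP[ax xb].
by move: xab; rewrite !ltW.
Qed.

Lemma test_outside phi x : test_function phi -> ~ I01 x -> phi x = 0.
Proof.
move=> [_ _ sI] nI; apply: contrapT => /eqP px; apply: nI; apply: sI.
exact: subset_closure.
Qed.

Lemma test_prim_derive1 phi : test_function phi -> forall x, prim (derive1 phi) x = phi x.
Proof.
move=> tphi x; have [sphi _ _] := tphi.
have c1 : continuous (derive1 phi) by apply: smooth_continuous; exact: smooth_derive1.
have n0 : ~ I01 0 by rewrite /= in_itv/= ltxx.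
have phi0 := test_outside tphi n0.
have H y : 0 <= y <= 1 -> prim (derive1 phi) y = phi y.
  by move=> y01; rewrite (prim_derive (smooth_is_derive sphi) c1 y01) phi0 subr0.
have [x0|/ltW x0] := leP x 0.
  rewrite prim_le0// (test_outside tphi)// /= in_itv/= => /andP[x_gt0 _].
  by move: x0; rewrite leNgt x_gt0.
have [x1|/ltW x1] := leP x 1; first by rewrite H// x0.
rewrite prim_ge1// -(@prim_ge1 _ _ 1)// H ?ler01 ?lexx//.
rewrite !(test_outside tphi)//= in_itv/= ?ltxx ?andbF//.
by move=> /andP[_ x_lt1]; move: x1; rewrite leNgt x_lt1.
Qed.

(** The zero mean makes the primitive vanish again to the right of the support. *)
Lemma prim_test psi (c d : R) : smooth psi -> 0 < c -> d < 1 ->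
  (forall x, ~~ (c <= x <= d) -> psi x = 0) -> \int[mu]_(t in I01) psi t = 0 ->
  test_function (prim psi) /\ derive1 (prim psi) = psi.
Proof.
move=> spsi c0 d1 psi0 ipsi.
have cpsi := smooth_continuous spsi.
have dprim (x : R) : is_derive x 1 (prim psi) (psi x).
  apply: prim_is_derive => // {}x nI; apply: psi0; apply/negP => /andP[cx xd].
  by apply: nI; rewrite /= in_itv/=; apply/andP; split; lra.
split; last exact: derive1_eq.
apply: (@test_of_support _ c d) => //.
  apply: (@smooth_of_class [set f | smooth f \/ f = prim psi]); last by right.
  move=> f [sf|->]; last by exists psi => //; left.
  exists (derive1 f); first by left; exact: smooth_derive1.
  exact: smooth_is_derive.
move=> x; rewrite negb_and -!ltNge => /orP[xc|dx].
  rewrite /prim (@eq_Rintegral _ _ _ mu _ (fun=> 0)).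
    by rewrite Rintegral_cst ?mul0r//; exact: mI01_ray.
  move=> t; rewrite inE/= => -[_]; rewrite in_itv/= => tx; apply: psi0.
  by rewrite negb_and -ltNge (le_lt_trans tx xc).
have [x1|/ltW x1] := leP 1 x; first by rewrite prim_ge1.
have := prim_sub (L1_continuous cpsi) x1.
rewrite (@prim_ge1 _ _ 1)// ipsi sub0r (@eq_Rintegral _ _ _ mu _ (fun=> 0)).
  rewrite Rintegral_cst ?mul0r; last exact: mI01_itv.
  by move=> /eqP; rewrite oppr_eq0 => /eqP.
move=> t; rewrite inE/= => -[_]; rewrite in_itv/= => /andP[xt _]; apply: psi0.
by rewrite negb_and -!ltNge (lt_trans dx xt) orbT.
Qed.

End test_functions.

(** * Charges on the line *)
Section charges_on_line.
Context {R : realType}.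
Local Notation mu := (@lebesgue_measure R).
Local Notation I01 := (`]0%R, 1%R[%classic : set R).
Local Notation mR := (measurableTypeR R).
Implicit Types (nu : {charge set mR -> \bar R}) (phi h : R -> R) (A : set mR).

Local Notation jpos nu := (jordan_pos (hahn_posneg nu)).
Local Notation jneg nu := (jordan_neg (hahn_posneg nu)).

Lemma charge_fin nu A : measurable A -> nu A \is a fin_num.
Proof. by move=> mA; exact: fin_num_measure. Qed.

Lemma charge_jordan nu A : measurable A -> nu A = (jpos nu A - jneg nu A)%E.
Proof. by move=> mA; rewrite (jordan_decomp (hahn_posneg nu) mA)/= /cadd/= cscaleN1. Qed.

Lemma finite_measure_bounded_cvg (m : {finite_measure set mR -> \bar R})
    (phi_ : nat -> R -> R) A : measurable A ->
  (forall n, measurable_fun [set: mR] (phi_ n)) ->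
  (forall n x, `|phi_ n x| <= 1) ->
  (forall x, phi_ n x @[n --> \oo] --> (\1_A x : R)) ->
  \int[m]_x phi_ n x @[n --> \oo] --> fine (m A).
Proof.
move=> mA mphi phi1 cphi.
have : (\int[m]_x (phi_ n x)%:E @[n --> \oo] --> \int[m]_x (\1_A x)%:E)%E.
  apply: (@dominated_cvg _ mR R m setT measurableT (fun n x => (phi_ n x)%:E)
    (fun x => (\1_A x)%:E) (fun=> 1%E)).
  - by move=> n; apply/measurable_EFinP; exact: mphi.
  - by move=> x _; apply: cvg_EFin; [exact: nearW|exact: cphi].
  - by [].
  - exact: (finite_measure_integrable_cst m 1 measurableT).
  - by move=> n x _; rewrite lee_fin.
rewrite integral_indic// setIT => H.
by apply: fine_cvg; rewrite fineK// fin_num_measure.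
Qed.

Lemma charge_bounded_cvg nu (phi_ : nat -> R -> R) A : measurable A ->
  (forall n, measurable_fun [set: mR] (phi_ n)) ->
  (forall n x, `|phi_ n x| <= 1) ->
  (forall x, phi_ n x @[n --> \oo] --> (\1_A x : R)) ->
  charge_integral nu (phi_ n) @[n --> \oo] --> fine (nu A).
Proof.
move=> mA mphi phi1 cphi; rewrite charge_jordan// fineB ?fin_num_measure//.
by apply: cvgB; exact: finite_measure_bounded_cvg.
Qed.

(** Finite measures agree as soon as they agree on rays; signed measures are reduced to this
    case by comparing nu1^+ + nu2^- with nu2^+ + nu1^-. *)
Lemma charge_eq_rays nu1 nu2 :
  (forall b, nu1 `]-oo, b[%classic = nu2 `]-oo, b[%classic) ->
  forall A, measurable A -> nu1 A = nu2 A.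
Proof.
move=> H.
have sumE (a b c d : \bar R) : a \is a fin_num -> b \is a fin_num ->
    c \is a fin_num -> d \is a fin_num ->
    (a - b = c - d <-> a + d = c + b)%E.
  move: a b c d => [a| |] [b| |] [c| |] [d| |] // _ _ _ _.
  by rewrite -!EFinB -!EFinD; split=> -[E]; congr (_%:E); lra.
have E A : measurable A -> nu1 A = nu2 A <->
    measure_add (jpos nu1) (jneg nu2) A = measure_add (jpos nu2) (jneg nu1) A.
  move=> mA; rewrite !measure_addE (charge_jordan nu1)// (charge_jordan nu2)//.
  by apply: sumE; rewrite fin_num_measure.
move=> A mA; apply/E => //.
apply: (@measure_unique _ R mR (@RGenInftyO.G R) (fun k => `]-oo, k%:R[%classic)
  _ _ _ _ (measure_add (jpos nu1) (jneg nu2)) (measure_add (jpos nu2) (jneg nu1))) => //.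
- exact: RGenInftyO.measurableE.
- move=> _ _ [x ->] [y ->]; exists (Num.min x y).
  by apply/seteqP; split => t /=; rewrite !in_itv/= lt_min => /andP.
- by move=> k; exists k%:R.
- apply/seteqP; split => // x _; exists (Num.bound `|x : R|) => //=.
  rewrite in_itv/=; apply: (le_lt_trans (ler_norm (x : R))).
  by apply: archi_boundP.
- by move=> _ [b ->]; apply/E => //; exact: measurable_itv.
- move=> k; have mk : measurable (`]-oo, k%:R[%classic : set mR) by exact: measurable_itv.
  apply: (eq_ind_r (fun z => (z < +oo)%E) _ (measure_addE (jpos nu1) (jneg nu2) _)).
  by rewrite lte_add_pinfty// ltey_eq fin_num_measure.
Qed.

(** The supports increase to (0, b) while the parameter in the exponential tends to 0. *)
Lemma bump_cvg (b : R) : 0 < b -> exists phi_ : nat -> R -> R,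
  [/\ (forall n, exists c d e : R, [/\ 0 < c, c < d, d < b & 0 < e /\ phi_ n = smooth_bump c d e]),
      (forall n x, `|phi_ n x| <= 1) &
      (forall x, phi_ n x @[n --> \oo] --> (\1_(`]0, b[ : set R) x : R))].
Proof.
move=> b0.
pose c n : R := b / 3 * harmonic n; pose d n : R := b - b / 3 * harmonic n.
have h0 n : 0 < harmonic n :> R by rewrite /harmonic/= invr_gt0.
have h1 n : harmonic n <= 1 :> R by rewrite /harmonic/= invf_le1// ler1n.
have b30 : 0 < b / 3 by rewrite divr_gt0.
have c0 n : 0 < c n by rewrite mulr_gt0.
have cd n : c n < d n.
  have : b / 3 * harmonic n <= b / 3 by rewrite ger_pMr.
  by rewrite /c /d; lra.
have db n : d n < b by rewrite /d gtrBl c0.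
exists (fun n => smooth_bump (c n) (d n) (harmonic n)); split.
- by move=> n; exists (c n), (d n), (harmonic n); split.
- move=> n x; rewrite ger0_norm ?bump_le1//; first exact: bump_ge0.
have cvgc : c n @[n --> \oo] --> 0.
  by rewrite -[X in _ --> X](mulr0 (b / 3)); apply: cvgMr; exact: cvg_harmonic.
have cvgd : d n @[n --> \oo] --> b.
  by rewrite -[X in _ --> X]subr0; apply: cvgB => //; exact: cvg_cst.
move=> x; have [xb|xb] := pselect (`]0, b[%classic x); last first.
  rewrite indicE memNset//=.
  rewrite [X in X @ _ --> _](_ : _ = fun=> 0); first exact: cvg_cst.
  apply/funext => n.
  rewrite bumpE; case: ifPn => // /andP[cx xd]; exfalso; apply: xb.
  by rewrite /= in_itv/= (lt_trans (c0 n) cx) (lt_trans xd (db n)).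
rewrite indicE mem_set//=.
move: xb; rewrite /= in_itv/= => /andP[x0 xb].
have H : expR (- harmonic n / ((x - c n) * (d n - x))) @[n --> \oo] --> (1 : R).
  rewrite -expR0; apply: (@continuous_cvg _ _ _ _ _ _ expR); first exact: continuous_expR.
  have -> : 0 = - 0 / ((x - 0) * (b - x)) by rewrite oppr0 mul0r.
  apply: cvgM; first by apply: cvgN; exact: cvg_harmonic.
  apply: cvgV; first by rewrite subr0 mulf_neq0 ?gt_eqF// subr_gt0.
  by apply: cvgM; apply: cvgB => //; exact: cvg_cst.
apply: cvg_trans H; apply: near_eq_cvg; near=> n.
rewrite bumpE ifT//; apply/andP; split.
  by near: n; exact: (cvgr_lt _ cvgc).
by near: n; exact: (cvgr_gt _ cvgd).
Unshelve. all: by end_near. Qed.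

Definition supported01 nu := forall A, measurable A -> A `&` I01 = set0 -> nu A = 0%E.

Lemma supported01_ray nu b : supported01 nu ->
  nu `]-oo, b[%classic = if b <= 0 then 0%E else nu `]0, (Num.min b 1)[%classic.
Proof.
move=> snu; case: ifPn => [b0|]; last rewrite -ltNge => b0.
  apply: snu; first exact: measurable_itv.
  by apply/seteqP; split => // t [] /=; rewrite !in_itv/=; lra.
have mr : measurable (`]-oo, b[%classic : set mR) by exact: measurable_itv.
have mi : measurable (`]0, Num.min b 1[%classic : set mR) by exact: measurable_itv.
rewrite (chargeDI nu mr mi) [X in (X + _)%E]snu ?add0e; last 2 first.
- exact: measurableD.
- apply/seteqP; split => // t [[/=]]; rewrite !in_itv/= lt_min => tb nt /andP[t0 t1].
  by apply: nt; rewrite t0 tb t1.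
congr (nu _); apply/seteqP; split => t [] /=; rewrite !in_itv/= !lt_min.
  by [].
by move=> /and3P[-> -> ->].
Qed.

(** The indicators of the intervals (0, b) are bounded limits of test functions, and determine
    a charge carried by the unit interval on all rays. *)
Lemma charge_eq_test nu1 nu2 : supported01 nu1 -> supported01 nu2 ->
  (forall a b c : R, 0 < a -> a < b -> b < 1 -> 0 < c ->
    charge_integral nu1 (smooth_bump a b c) = charge_integral nu2 (smooth_bump a b c)) ->
  forall A, measurable A -> nu1 A = nu2 A.
Proof.
move=> s1 s2 H; apply: charge_eq_rays => b.
rewrite !supported01_ray//; case: ifPn => //; rewrite -ltNge => b0.
have b0' : 0 < Num.min b 1 by rewrite lt_min b0 ltr01.
have b1 : Num.min b 1 <= 1 by rewrite ge_min lexx orbT.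
have mi : measurable (`]0, Num.min b 1[%classic : set mR) by exact: measurable_itv.
have [phi_ [tphi phi1 cphi]] := bump_cvg b0'.
have mphi n : measurable_fun [set: mR] (phi_ n).
  apply: continuous_measurable_fun; have [c [d [e [c0 cd db [e0 ->]]]]] := tphi n.
  by apply: smooth_continuous; exact: bump_smooth.
have c1 := @charge_bounded_cvg nu1 _ _ mi mphi phi1 cphi.
have c2 := @charge_bounded_cvg nu2 _ _ mi mphi phi1 cphi.
rewrite -[LHS]fineK ?charge_fin// -[RHS]fineK ?charge_fin//; congr (_%:E).
have E : (fun n => charge_integral nu1 (phi_ n)) = (fun n => charge_integral nu2 (phi_ n)).
  apply/funext => n; have [c [d [e [c0 cd db [e0 ->]]]]] := tphi n.
  by apply: H => //; exact: lt_le_trans b1.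
rewrite E in c1.
by rewrite -(cvg_lim (@norm_hausdorff _ _) c1) -(cvg_lim (@norm_hausdorff _ _) c2).
Qed.

End charges_on_line.

(** * Distribution functions of charges *)
Section distribution.
Context {R : realType}.
Local Notation mu := (@lebesgue_measure R).
Local Notation I01 := (`]0%R, 1%R[%classic : set R).
Local Notation mR := (measurableTypeR R).
Implicit Types (nu : {charge set mR -> \bar R}) (phi h : R -> R) (A : set mR).

Local Notation jpos nu := (jordan_pos (hahn_posneg nu)).
Local Notation jneg nu := (jordan_neg (hahn_posneg nu)).

Lemma prim_tail h (t : R) : L1 h ->
  \int[mu]_(x in I01 `&` `]t, +oo[) h x = prim h 1 - prim h t.
Proof.
move=> ih; rewrite (@prim_ge1 _ _ 1)//.
have -> : \int[mu]_(x in I01) h x =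
    \int[mu]_(x in (I01 `&` `]-oo, t]) `|` (I01 `&` `]t, +oo[)) h x.
  congr (Rintegral _ _ _); apply/seteqP; split => x /=; rewrite !in_itv/=; last by case=> -[].
  by move=> ?; have [|] := leP x t; [left|right].
have mt : measurable (I01 `&` `]t, +oo[ : set mR) by exact: measurableI.
have mt' : measurable (I01 `&` `]-oo, t] : set mR) by exact: measurableI.
rewrite Rintegral_setU//; first by rewrite /prim addrC addKr.
  apply: (L1_subset _ _ ih); first exact: measurableU.
  by move=> x [] [].
by apply/disj_setPS => x [] [_ /=] + [_ /=]; rewrite !in_itv/=; lra.
Qed.

(** Both sides are the integral of h x * k t over the triangle t < x. *)
Lemma fubini_ray (m : {sigma_finite_measure set mR -> \bar R}) (k : mR -> R) h (M : R) :
  m.-integrable setT (EFin \o k) -> measurable_fun I01 h ->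
  (forall t, I01 t -> `|h t| <= M) ->
  \int[mu]_(x in I01) ((\int[m]_(t in `]-oo, x[) k t) * h x)
  = \int[m]_t (k t * (prim h 1 - prim h t)).
Proof.
move=> ik mh hM.
have ih : L1 h by exact: L1_bounded hM.
pose H := h \_ I01.
pose f (z : mR * mR) : R := if z.2 < z.1 then H z.1 * k z.2 else 0.
have mH : measurable_fun [set: mR] H by exact/(measurable_restrictT _ mI01).
have mk : measurable_fun [set: mR] k by move/integrableP: ik => [/measurable_EFinP].
have HM x : `|H x| <= `|M|.
  rewrite /H patchE; case: ifPn => [|_]; last by rewrite normr0.
  by rewrite inE => /hM /le_trans; apply; exact: ler_norm.
have mf : measurable_fun [set: mR * mR] (EFin \o f).
  apply/measurable_EFinP; apply: measurable_fun_ifT.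
  - by apply: measurable_fun_ltr; [exact: measurable_snd|exact: measurable_fst].
  - apply: measurable_funM; apply: measurableT_comp => //.
  - exact: measurable_cst.
have iH : mu.-integrable setT (EFin \o H).
  by rewrite /H -restrict_EFin; apply/(integrable_mkcond _ mI01).
have iray x : m.-integrable `]-oo, x[ (EFin \o k).
  by apply: integrableS ik => //; exact: measurable_itv.
have fE1 x : (\int[m]_y (f (x, y))%:E)%E = (H x * \int[m]_(t in `]-oo, x[) k t)%:E.
  rewrite EFinM /Rintegral fineK; last first.
    by apply: integrable_fin_num; [exact: measurable_itv|exact: iray].
  rewrite -integralZl; [|exact: measurable_itv|exact: iray].
  rewrite [RHS]integral_mkcond; apply: eq_integral => y _.
  rewrite patchE /f/=; case: ifPn => yx; case: ifPn => //.
    by rewrite notin_setE/= in_itv/= yx.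
  by rewrite inE/= in_itv/= (negbTE yx).
have fE2 y : (\int[mu]_x (f (x, y))%:E)%E = (k y * (prim h 1 - prim h y))%:E.
  have mt : measurable (I01 `&` `]y, +oo[ : set mR) by exact: measurableI.
  have iht : mu.-integrable (I01 `&` `]y, +oo[) (EFin \o h).
    by apply: L1_subset ih => // x [].
  rewrite -prim_tail// EFinM /Rintegral fineK; last exact: integrable_fin_num.
  rewrite -integralZl// [RHS]integral_mkcond; apply: eq_integral => x _.
  rewrite patchE /f/= /H patchE in_setI; case: ifPn => yx.
    have -> : (x \in (`]y, +oo[%classic : set R)) by rewrite inE/= in_itv/= yx.
    by rewrite andbT; case: ifPn => _; rewrite ?mul0r// mulrC.
  rewrite ifF//; apply/negbTE; rewrite negb_and; apply/orP; right.
  by rewrite notin_setE/= in_itv/= andbT; apply/negP.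
have intf : (mu \x m)%E.-integrable setT (EFin \o f).
  apply/integrable12ltyP => //=.
  have [c cE] : exists c : R, (\int[m]_y `|(k y)%:E|)%E = c%:E.
    have := integrable_fin_num measurableT (integrable_abse ik).
    by move=> /fineK <-; eexists.
  have : mu.-integrable setT (fun x => c%:E * `|(H x)%:E|)%E.
    by apply: integrableZl => //; exact: (integrable_abse iH).
  move=> /(integrable_lty measurableT); apply: le_lt_trans.
  apply: ge0_le_integral => //.
  - by move=> x _; apply: integral_ge0.
  - apply: (@measurable_fun_fubini_tonelli_F _ _ _ _ _ m (abse \o (EFin \o f))) => //.
    exact: measurableT_comp.
    by move=> z; exact: abse_ge0.
  - apply: measurable_funeM; apply: measurableT_comp => //.
    exact/measurable_EFinP.
  - move=> x _; rewrite -cE muleC -ge0_integralZl//; last first.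
      by apply: measurableT_comp => //; exact/measurable_EFinP.
    apply: ge0_le_integral => //.
    + apply: measurableT_comp => //; apply: measurableT_comp => //.
      rewrite /f/=; apply/measurable_EFinP.
      apply/measurable_EFinP; apply: measurable_fun_ifT.
      * by apply: measurable_fun_ltr => //; exact: measurable_cst.
      * by apply: measurable_funM => //; exact: measurable_cst.
      * exact: measurable_cst.
    + apply: measurable_funeM; apply: measurableT_comp => //.
      exact/measurable_EFinP.
    + move=> y _; rewrite /f/=; case: ifPn => _; first by rewrite normrM.
      by rewrite normr0 lee_fin mulr_ge0.
have := @Fubini _ _ mR mR R mu m (EFin \o f) intf.
under eq_integral do rewrite fE1.
under [X in _ = X -> _]eq_integral do rewrite fE2.
move=> E; rewrite /Rintegral [LHS](_ : _ = fine (\int[mu]_x (H x * \int[m]_(t in `]-oo, x[) k t)%:E)%E).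
  by rewrite E.
congr fine; rewrite integral_mkcond; apply: eq_integral => x _.
rewrite /H !patchE; case: ifPn => _; last by rewrite mul0r.
by rewrite mulrC.
Qed.

Lemma prim_clamp h x : prim h x = prim h (clamp 0 1 x).
Proof.
have [x0|/ltW x0] := leP x 0.
  by rewrite !prim_le0// /clamp ge_max lexx ge_min x0 orbT.
have [x1|/ltW x1] := leP x 1; first by rewrite clamp_id// x0.
by rewrite /clamp (min_idPl x1) (max_idPr ler01) !prim_ge1.
Qed.

Lemma prim_bounded h (M : R) : L1 h -> 0 <= M ->
  (forall t, I01 t -> `|h t| <= M) -> forall x, `|prim h x| <= M.
Proof.
move=> ih M0 hM x; rewrite prim_clamp; have /andP[c0 c1] := clamp_itv x (@ler01 R).
rewrite -[prim _ _]subr0 -[X in _ - X](@prim_le0 _ h 0)//.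
apply: (le_trans (prim_sub_le _ _ ih M0 hM)).
by rewrite subr0 ger0_norm// ler_piMr.
Qed.

Definition distf nu (x : R) : R := fine (nu `]-oo, x[%classic).

Lemma distf_jordan nu x :
  distf nu x = fine (jpos nu `]-oo, x[%classic) - fine (jneg nu `]-oo, x[%classic).
Proof.
have mr : measurable (`]-oo, x[%classic : set mR) by exact: measurable_itv.
by rewrite /distf charge_jordan// fineB ?fin_num_measure.
Qed.

Lemma measure_ray_bounded (m : {finite_measure set mR -> \bar R}) :
  measurable_fun I01 (fun x => fine (m `]-oo, x[%classic)) /\
  forall t, I01 t -> `|fine (m `]-oo, t[%classic)| <= fine (m setT).
Proof.
have mr x : measurable (`]-oo, x[%classic : set mR) by exact: measurable_itv.
split.
  apply: measurable_funTS; apply: nondecreasing_measurable => // x y xy.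
  rewrite fine_le ?fin_num_measure// le_measure ?inE//.
  by move=> t /=; rewrite !in_itv/= => /lt_le_trans; apply.
move=> t _; rewrite ger0_norm ?fine_ge0//.
by rewrite fine_le ?fin_num_measure// le_measure ?inE.
Qed.

Lemma L1_distf nu : L1 (distf nu).
Proof.
have [m1 b1] := measure_ray_bounded (jpos nu).
have [m2 b2] := measure_ray_bounded (jneg nu).
have := L1B (L1_bounded m1 b1) (L1_bounded m2 b2).
by apply: eq_integrable => // x _; rewrite /= distf_jordan.
Qed.

Lemma integrable_prim (m : {finite_measure set mR -> \bar R}) h (M : R) :
  measurable_fun I01 h -> (forall t, I01 t -> `|h t| <= M) ->
  m.-integrable setT (EFin \o prim h).
Proof.
move=> mh hM.
have M0 : 0 <= M.
  by apply: (le_trans (normr_ge0 (h (2^-1)))); apply: hM; rewrite /= in_itv/=; lra.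
apply: measurable_bounded_integrable => //.
- by rewrite ltey_eq fin_num_measure.
- by apply: continuous_measurable_fun; exact: prim_continuous hM.
- exists M; split; first exact: num_real.
  move=> x Mx t _; apply: (le_trans _ (ltW Mx)).
  by apply: prim_bounded => //; exact: L1_bounded hM.
Qed.

(** Fubini on the triangle t < x for each of the two Jordan parts. *)
Lemma charge_integral_prim nu h (M : R) : measurable_fun I01 h ->
  (forall t, I01 t -> `|h t| <= M) -> prim h 1 = 0 ->
  charge_integral nu (prim h) = - \int[mu]_(x in I01) (distf nu x * h x).
Proof.
move=> mh hM h1.
have key (m : {finite_measure set mR -> \bar R}) :
    \int[mu]_(x in I01) (fine (m `]-oo, x[%classic) * h x) = - \int[m]_t prim h t.
  have i1 : m.-integrable setT (EFin \o fun=> 1) by exact: finite_measure_integrable_cst.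
  have := @fubini_ray m (fun=> 1) h M i1 mh hM.
  rewrite h1 => E; transitivity (\int[m]_t (1 * (0 - prim h t))).
    rewrite -E; apply: eq_Rintegral => x _.
    by rewrite Rintegral_cst ?mul1r//; exact: measurable_itv.
  rewrite -mulN1r -RintegralZl//; last exact: integrable_prim hM.
  by apply: eq_Rintegral => x _; rewrite mul1r sub0r mulN1r.
have [m1 b1] := measure_ray_bounded (jpos nu).
have [m2 b2] := measure_ray_bounded (jneg nu).
rewrite /charge_integral.
have -> : \int[mu]_(x in I01) (distf nu x * h x) =
  \int[mu]_(x in I01) (fine (jpos nu `]-oo, x[%classic) * h x
    - fine (jneg nu `]-oo, x[%classic) * h x).
  by apply: eq_Rintegral => x _; rewrite distf_jordan mulrBl.
rewrite RintegralB//.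
- by rewrite !key opprB opprK addrC.
- by apply: (L1M (M := M)) => //; exact: L1_bounded b1.
- by apply: (L1M (M := M)) => //; exact: L1_bounded b2.
Qed.

End distribution.

(** * Distributional derivatives *)
Section distributional.
Context {R : realType}.
Local Notation mu := (@lebesgue_measure R).
Local Notation I01 := (`]0%R, 1%R[%classic : set R).
Local Notation mR := (measurableTypeR R).
Implicit Types (nu : {charge set mR -> \bar R}) (phi h g v w : R -> R) (A : set mR).

Lemma ae_imp (P Q : R -> Prop) : (forall x, P x -> Q x) ->
  (\forall x \ae mu, P x) -> (\forall x \ae mu, Q x).
Proof. by move=> PQ; apply: (@filterS _ _ (ae_filter_ringOfSetsType mu)). Qed.

Lemma ae_imp2 (P Q S : R -> Prop) : (forall x, P x -> Q x -> S x) ->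
  (\forall x \ae mu, P x) -> (\forall x \ae mu, Q x) -> (\forall x \ae mu, S x).
Proof. by move=> PQS; apply: (@filterS2 _ _ (ae_filter_ringOfSetsType mu)). Qed.

Lemma eq_ae_Rintegral (f g : R -> R) : measurable_fun I01 f -> measurable_fun I01 g ->
  (\forall x \ae mu, I01 x -> f x = g x) ->
  \int[mu]_(x in I01) f x = \int[mu]_(x in I01) g x.
Proof.
move=> mf mg fg; rewrite /Rintegral; congr fine; apply: ae_eq_integral => //.
- exact/measurable_EFinP.
- exact/measurable_EFinP.
- by apply: ae_imp fg => x H Ix; rewrite H.
Qed.

Lemma L1_restrict g : L1 g -> mu.-integrable [set: mR] (EFin \o (g \_ I01)).
Proof. by move=> ig; rewrite -restrict_EFin; apply/(integrable_mkcond _ mI01). Qed.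

Definition density_charge g (ig : L1 g) : {charge set mR -> \bar R} :=
  induced_charge (L1_restrict ig).

Lemma density_chargeE g (ig : L1 g) A :
  density_charge ig A = (\int[mu]_(x in A `&` I01) (g x)%:E)%E.
Proof. by rewrite /density_charge/= /induced_charge integral_mkcondr restrict_EFin. Qed.

Lemma density_charge_supported g (ig : L1 g) : supported01 (density_charge ig).
Proof. by move=> A mA A0; rewrite density_chargeE A0 integral_set0. Qed.

Lemma distf_density g (ig : L1 g) x : distf (density_charge ig) x = prim g x.
Proof.
rewrite /distf density_chargeE /prim /Rintegral; congr fine.
have mr : measurable (`]-oo, x[ : set mR) by exact: measurable_itv.
have mr' : measurable (`]-oo, x] : set mR) by exact: measurable_itv.
rewrite setIC integral_mkcondl [RHS]integral_mkcondl.
apply: integral_itv_bndo_bndc.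
have /integrableP[m _] := L1_restrict ig.
by rewrite restrict_EFin; apply: measurable_funTS.
Qed.

(** Fubini on the triangle t < x for the signed measure of density g. *)
Lemma prim_by_parts g h (M : R) : L1 g -> measurable_fun I01 h ->
  (forall t, I01 t -> `|h t| <= M) -> prim h 1 = 0 ->
  \int[mu]_(x in I01) (prim g x * h x) = - \int[mu]_(x in I01) (g x * prim h x).
Proof.
move=> ig mh hM h1.
have := @fubini_ray R mu (g \_ I01) h M (L1_restrict ig) mh hM.
have -> : \int[mu]_(x in I01) ((\int[mu]_(t in `]-oo, x[) (g \_ I01) t) * h x) =
    \int[mu]_(x in I01) (prim g x * h x).
  apply: eq_Rintegral => x _; congr (_ * _).
  by rewrite -(distf_density ig) /distf density_chargeE /Rintegral
    integral_mkcondr restrict_EFin.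
move=> ->; rewrite h1.
have ip : L1 (fun t => g t * prim h t).
  have M0 : 0 <= M.
    by apply: (le_trans (normr_ge0 (h (2^-1)))); apply: hM; rewrite /= in_itv/=; lra.
  apply: (L1M (M := M)) => //.
    apply: measurable_funTS; apply: continuous_measurable_fun.
    exact: prim_continuous hM.
  by move=> t _; apply: prim_bounded => //; exact: L1_bounded hM.
rewrite -mulN1r -RintegralZl// [RHS]Rintegral_mkcond.
apply: eq_Rintegral => x _; rewrite !patchE; case: ifPn => _; last by rewrite mul0r.
by rewrite sub0r mulrN mulN1r.
Qed.

Lemma density_charge_integral g (ig : L1 g) h (M : R) : measurable_fun I01 h ->
  (forall t, I01 t -> `|h t| <= M) -> prim h 1 = 0 ->
  charge_integral (density_charge ig) (prim h) = \int[mu]_(x in I01) (g x * prim h x).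
Proof.
move=> mh hM h1; rewrite (charge_integral_prim _ mh hM h1).
have -> : \int[mu]_(x in I01) (distf (density_charge ig) x * h x) =
  \int[mu]_(x in I01) (prim g x * h x).
  by apply: eq_Rintegral => x _; rewrite distf_density.
by rewrite (prim_by_parts ig mh hM h1) opprK.
Qed.

(** Test functions are primitives of bounded functions with zero mean, which is all that the
    integration by parts formulas use. *)
Lemma test_prim phi : test_function phi ->
  exists h M, [/\ measurable_fun I01 h, (forall t, I01 t -> `|h t| <= M),
    prim h 1 = 0, phi = prim h & h = derive1 phi].
Proof.
move=> tphi; have [sphi _ _] := tphi.
have c1 : continuous (derive1 phi) by apply: smooth_continuous; exact: smooth_derive1.
have [M M0 hM] := continuous_bounded01 c1.
exists (derive1 phi), M; split => //.
- by apply: measurable_funTS; exact: continuous_measurable_fun.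
- by rewrite test_prim_derive1// (test_outside tphi)//= in_itv/= ltxx andbF.
- by apply/funext => x; rewrite test_prim_derive1.
Qed.

Lemma density_charge_test g (ig : L1 g) phi : test_function phi ->
  charge_integral (density_charge ig) phi = \int[mu]_(x in I01) (g x * phi x).
Proof.
move=> /test_prim[h [M [mh hM h1 -> _]]].
exact: density_charge_integral mh hM h1.
Qed.

Lemma density_charge_inj g1 g2 (ig1 : L1 g1) (ig2 : L1 g2) :
  (forall A, measurable A -> density_charge ig1 A = density_charge ig2 A) ->
  \forall x \ae mu, I01 x -> g1 x = g2 x.
Proof.
move=> H.
have : ae_eq mu I01 (EFin \o g1) (EFin \o g2).
  apply: integral_ae_eq => //.
  - exact: (measurable_int mu ig2).
  - move=> E EI mE; have := H _ mE; rewrite !density_chargeE.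
    by rewrite setIidl.
by apply: ae_imp => x Hx Ix; have [] := Hx Ix.
Qed.

(** A bump minus the multiple of a fixed bump psi0 with the same mean is the derivative of a
    test function. Hence the integrals of v and of the constant c, the psi0-average of v,
    against any bump agree, and bumps determine densities. *)
Lemma du_bois_reymond v : L1 v ->
  (forall phi, test_function phi -> \int[mu]_(x in I01) (v x * derive1 phi x) = 0) ->
  exists c, \forall x \ae mu, I01 x -> v x = c.
Proof.
move=> iv vphi.
pose psi0 : R -> R := smooth_bump (1/4) (3/4) 1.
have q13 : 1 / 4 < 3 / 4 :> R by lra.
have q0 : 0 < 1 / 4 :> R by lra.
have q1 : 3 / 4 < 1 :> R by lra.
have spsi0 : smooth psi0 by apply: bump_smooth.
have i0 : L1 psi0 by apply: L1_continuous; exact: smooth_continuous.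
have psi0_ge0 t : 0 <= psi0 t by apply: bump_ge0.
pose kap := \int[mu]_(x in I01) psi0 x.
(* on [3/8, 5/8] one has (x - 1/4) (3/4 - x) >= 1/64, hence psi0 >= exp (- 64) *)
have kap0 : 0 < kap.
  rewrite /kap -(@prim_ge1 _ _ 1)//.
  have A1 : 0 <= prim psi0 (3/8) by apply: Rintegral_ge0.
  have A2 : expR (- 64) * (5/8 - 3/8) <= prim psi0 (5/8) - prim psi0 (3/8).
    apply: prim_sub_ge => //; try lra.
    move=> t It /andP[t3 t5]; rewrite /psi0 bumpE ifT; last by apply/andP; split; lra.
    rewrite ler_expR mulN1r lerN2 -(invrK 64) lef_pV2 ?posrE; last 2 first.
    - by rewrite mulr_gt0// subr_gt0; lra.
    - by rewrite invr_gt0; lra.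
    by nra.
  have A3 : 0 <= prim psi0 1 - prim psi0 (5/8).
    by rewrite -(mul0r (1 - 5/8)); apply: prim_sub_ge => //; lra.
  have := @expR_gt0 R (- 64); lra.
pose c := (\int[mu]_(x in I01) (v x * psi0 x)) / kap.
exists c.
have ic := @L1_cst R c.
have := density_charge_inj (ig1 := iv) (ig2 := ic); apply.
apply: charge_eq_test; [exact: density_charge_supported..|].
move=> a b e a0 ab b1 e0.
pose psi : R -> R := smooth_bump a b e.
have tpsi : test_function psi by exact: bump_test.
have spsi : smooth psi by apply: bump_smooth.
rewrite !density_charge_test//; rewrite -/psi.
have ipsi : L1 psi by apply: L1_continuous; exact: smooth_continuous.
pose r := (\int[mu]_(x in I01) psi x) / kap.
pose eta x := psi x + (- r) * psi0 x.
have seta : smooth eta by exact: smooth_lin.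
have ieta : \int[mu]_(x in I01) eta x = 0.
  rewrite /eta RintegralD//; last exact: L1Z.
  by rewrite RintegralZl// -/kap mulNr /r divfK ?subrr// gt_eqF.
have eta0 x : ~~ (Num.min a (1/4) <= x <= Num.max b (3/4)) -> eta x = 0.
  rewrite /eta /psi /psi0 !bumpE => H.
  rewrite !ifF ?mulr0 ?addr0//; apply/negbTE; apply: contra H => /andP[? ?].
    by rewrite ge_min le_max; apply/andP; split; apply/orP; right; exact: ltW.
  by rewrite ge_min le_max; apply/andP; split; apply/orP; left; exact: ltW.
have [] := @prim_test R eta (Num.min a (1/4)) (Num.max b (3/4)) seta _ _ eta0 ieta.
- by rewrite lt_min a0.
- by rewrite gt_max b1.
move=> teta deta; have := vphi _ teta; rewrite deta.
have mbump (f : R -> R) : smooth f -> measurable_fun I01 f.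
  by move=> sf; apply: measurable_funTS; apply: continuous_measurable_fun; exact: smooth_continuous.
have n1 t : I01 t -> `|psi t| <= 1 by move=> _; rewrite ger0_norm ?bump_le1// bump_ge0.
have n2 t : I01 t -> `|psi0 t| <= 1 by move=> _; rewrite ger0_norm ?bump_le1// bump_ge0.
have iv1 : L1 (fun x => v x * psi x) by apply: (L1M (M := 1)) => //; exact: mbump.
have iv2 : L1 (fun x => v x * psi0 x) by apply: (L1M (M := 1)) => //; exact: mbump.
have -> : \int[mu]_(x in I01) (v x * eta x) =
    \int[mu]_(x in I01) (v x * psi x) - r * \int[mu]_(x in I01) (v x * psi0 x).
  rewrite -RintegralZl// -RintegralB//; last exact: L1Z.
  by apply: eq_Rintegral => x _; rewrite /eta; ring.
move=> /eqP; rewrite subr_eq0 => /eqP ->; rewrite RintegralZl// /r /c.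
by ring.
Qed.

(** By parts, the distribution function of nu has nu as its distributional derivative;
    du Bois-Reymond's lemma applies to the difference. *)
Lemma distributional_distf w nu : is_distributional_derivative w nu ->
  exists c, \forall x \ae mu, I01 x -> w x = c + distf nu x.
Proof.
move=> [iw snu Hnu].
have id := L1_distf nu.
have [|phi tphi|c Hc] := @du_bois_reymond (fun x => w x - distf nu x).
- exact: L1B.
- have [h [M [mh hM h1 phiE hE]]] := test_prim tphi.
  have -> : \int[mu]_(x in I01) ((w x - distf nu x) * derive1 phi x) =
      \int[mu]_(x in I01) (w x * derive1 phi x) -
      \int[mu]_(x in I01) (distf nu x * derive1 phi x).
    rewrite -hE -RintegralB//; [|exact: (L1M (M := M))..].
    by apply: eq_Rintegral => x _; rewrite mulrBl.
  by rewrite Hnu// -hE phiE (charge_integral_prim _ mh hM h1) opprK subrr.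
by exists c; apply: ae_imp Hc => x Hx Ix; rewrite -(Hx Ix) subrK.
Qed.

Lemma distf_integral (c : R) w nu h (M : R) : L1 w ->
  (\forall x \ae mu, I01 x -> w x = c + distf nu x) ->
  measurable_fun I01 h -> (forall t, I01 t -> `|h t| <= M) -> prim h 1 = 0 ->
  \int[mu]_(x in I01) (w x * h x) = - charge_integral nu (prim h).
Proof.
move=> iw wE mh hM h1; rewrite (charge_integral_prim _ mh hM h1) opprK.
have ih : L1 h by exact: L1_bounded hM.
have id := L1_distf nu.
have idh : L1 (fun x => distf nu x * h x) by exact: (L1M (M := M)).
transitivity (\int[mu]_(x in I01) (c * h x + distf nu x * h x)).
  apply: eq_ae_Rintegral.
  - by apply: measurable_funM => //; exact: L1_measurable.
  - by apply: L1_measurable; apply: L1D => //; exact: L1Z.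
  - by apply: ae_imp wE => x H Ix; rewrite H// mulrDl.
rewrite RintegralD//; last exact: L1Z.
by rewrite RintegralZl// -(@prim_ge1 _ h 1)// h1 mulr0 add0r.
Qed.

(** This extends the definition of a distributional derivative from test functions to
    primitives of bounded measurable functions, which are merely Lipschitz. *)
Lemma distributional_pairing w nu h (M : R) : is_distributional_derivative w nu ->
  measurable_fun I01 h -> (forall t, I01 t -> `|h t| <= M) -> prim h 1 = 0 ->
  \int[mu]_(x in I01) (w x * h x) = - charge_integral nu (prim h).
Proof.
move=> wnu; have [c wE] := distributional_distf wnu; have [iw _ _] := wnu.
exact: distf_integral iw wE.
Qed.

Lemma distributional_unique w nu1 nu2 :
  is_distributional_derivative w nu1 -> is_distributional_derivative w nu2 ->
  forall A, measurable A -> nu1 A = nu2 A.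
Proof.
move=> [_ s1 H1] [_ s2 H2]; apply: charge_eq_test => // a b c a0 ab b1 c0.
have tb := bump_test a0 ab b1 c0.
by apply: oppr_inj; rewrite -H1// -H2.
Qed.

Lemma weak_distributional w g (ig : L1 g) : is_weak_derivative w g ->
  is_distributional_derivative w (density_charge ig).
Proof.
move=> [iw _ H]; split => //; first exact: density_charge_supported.
by move=> phi tphi; rewrite H// density_charge_test.
Qed.

Lemma weak_unique w g1 g2 : is_weak_derivative w g1 -> is_weak_derivative w g2 ->
  \forall x \ae mu, I01 x -> g1 x = g2 x.
Proof.
move=> wg1 wg2; have [_ i1 _] := wg1; have [_ i2 _] := wg2.
apply: (density_charge_inj (ig1 := i1) (ig2 := i2)).
apply: (@distributional_unique w); exact: weak_distributional.
Qed.

Lemma prim_weak (c : R) w g : L1 w -> L1 g -> (forall x, I01 x -> w x = c + prim g x) ->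
  is_weak_derivative w g.
Proof.
move=> iw ig wE; split => // phi tphi.
have [h [M [mh hM h1 -> hE]]] := test_prim tphi.
rewrite -hE -(density_charge_integral ig mh hM h1).
apply: (@distf_integral c w (density_charge ig) h M) => //.
by apply: aeW => x Ix; rewrite distf_density wE.
Qed.

End distributional.

(** * The Lebesgue decomposition *)
Section lebesgue_decomposition.
Context {R : realType}.
Local Notation mu := (@lebesgue_measure R).
Local Notation I01 := (`]0%R, 1%R[%classic : set R).
Local Notation mR := (measurableTypeR R).
Implicit Types (nu s : {charge set mR -> \bar R}) (g : R -> R) (A N : set mR).

Local Notation jpos nu := (jordan_pos (hahn_posneg nu)).
Local Notation jneg nu := (jordan_neg (hahn_posneg nu)).

Lemma jposE nu A : measurable A -> jpos nu A = nu (A `&` hahn_pos nu).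
Proof. by move=> mA; rewrite jordan_posE cjordan_posE /crestr0 mem_set. Qed.

Lemma jnegE nu A : measurable A -> jneg nu A = (- nu (A `&` hahn_neg nu))%E.
Proof. by move=> mA; rewrite jordan_negE cjordan_negE /crestr0 mem_set. Qed.

Lemma total_variation_fin s A : measurable A -> total_variation_charge s A \is a fin_num.
Proof.
by move=> mA; rewrite /total_variation_charge /charge_variation/= fin_numD !fin_num_measure.
Qed.

Lemma total_variation_charge_ge0 s A : (0 <= total_variation_charge s A)%E.
Proof. exact: measure_ge0. Qed.

Lemma total_variation_czero A : measurable A ->
  total_variation_charge (czero : {charge set mR -> \bar R}) A = 0%E.
Proof.
move=> mA; rewrite /total_variation_charge /charge_variation/=.
have E1 := jposE (czero : {charge set mR -> \bar R}) mA.
have E2 := jnegE (czero : {charge set mR -> \bar R}) mA.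
rewrite [X in (X + _)%E]E1 [X in (_ + X)%E]E2.
exact: (sube0 (0%E : \bar R)).
Qed.

(** The Hahn decomposition is chosen charge by charge, and charges may differ on sets that
    are not measurable; but a Hahn decomposition of s1 is one of s2, and any two of them give
    the same variation. *)
Lemma total_variation_eq s1 s2 : (forall A, measurable A -> s1 A = s2 A) ->
  forall A, measurable A -> total_variation_charge s1 A = total_variation_charge s2 A.
Proof.
move=> H A mA.
have [[mP pP] [mN nN] PN PN0] := hahn_posneg s1.
have h2 : hahn_decomposition s2 (hahn_pos s1) (hahn_neg s1).
  split => //; split => // B mB BP; rewrite -H//; first exact: pP.
  exact: nN.
have [E1 E2] := Hahn_decomposition_uniq h2 (hahn_posneg s2) mA.
rewrite /total_variation_charge /charge_variation/=; congr (_ + _)%E.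
- by rewrite [LHS]jposE// [RHS]jposE// H//; exact: measurableI.
- by rewrite [LHS]jnegE// [RHS]jnegE// H ?E2//; exact: measurableI.
Qed.

Lemma total_variation_null s N A : measurable N -> measurable A ->
  total_variation_charge s (~` N) = 0%E -> A `<=` ~` N -> s A = 0%E.
Proof.
move=> mN mA sN AN; apply/eqP; rewrite -abse_eq0; apply/eqP/le_anti.
rewrite abse_ge0 andbT; apply: (le_trans (abse_charge_variation (hahn_posneg s) mA)).
rewrite -sN; apply: le_measure; rewrite ?inE//; exact: measurableC.
Qed.

(** On the union of the two null carriers the densities contribute nothing, and outside of it
    the singular parts vanish. *)
Lemma lebesgue_decomposition_uniq nu g1 g2 s1 s2 :
  is_lebesgue_decomposition nu g1 s1 -> is_lebesgue_decomposition nu g2 s2 ->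
  (forall A, measurable A -> s1 A = s2 A) /\ \forall x \ae mu, I01 x -> g1 x = g2 x.
Proof.
move=> [i1 [N1 [mN1 muN1 sN1]] H1] [i2 [N2 [mN2 muN2 sN2]] H2].
pose N := N1 `|` N2.
have mN : measurable N by exact: measurableU.
have muN : mu N = 0%E.
  by apply: null_set_setU.
have s12 A : measurable A -> s1 A = s2 A.
  move=> mA; rewrite (chargeDI s1 mA mN) (chargeDI s2 mA mN).
  have mD : measurable (A `\` N) by exact: measurableD.
  have mI : measurable (A `&` N) by exact: measurableI.
  rewrite (total_variation_null mN1 mD sN1); last by move=> x [_ nN] N1x; apply: nN; left.
  rewrite (total_variation_null mN2 mD sN2); last by move=> x [_ nN] N2x; apply: nN; right.
  rewrite !add0e.
  have null (g : R -> R) : L1 g -> (\int[mu]_(x in (A `&` N) `&` I01) (g x)%:E = 0)%E.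
    move=> ig; apply: null_set_integral.
    - by apply: measurableI => //; exact: mI01.
    - apply: measurable_funS (measurable_int mu ig); first exact: mI01.
      by move=> x [].
    - by apply: subset_measure0 muN => //; [apply: measurableI => //; exact: mI01|move=> x [[]]].
  by have := H1 _ mI; rewrite H2// !null// !add0e.
split => //; apply: (density_charge_inj (ig1 := i1) (ig2 := i2)) => A mA.
rewrite !density_chargeE; have := H1 _ mA; rewrite H2// s12//.
have f2 := charge_fin s2 mA.
by move=> /(congr1 (fun z => z - s2 A)%E); rewrite !addeK.
Qed.

(** Let N be a Lebesgue null set of maximal |nu|-measure. By maximality |nu| vanishes on the
    null sets disjoint from N, so that nu restricted to the complement of N is absolutely
    continuous and has a Radon-Nikodym density; nu restricted to N is singular. *)
Lemma lebesgue_decomposition_exists nu : supported01 nu ->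
  exists g s, is_lebesgue_decomposition nu g s.
Proof.
move=> snu.
pose m := charge_variation (hahn_posneg nu).
pose S := [set fine (m N) | N in [set N | measurable N /\ mu N = 0%E]].
have mfin A : measurable A -> m A \is a fin_num.
  by move=> mA; rewrite /m /charge_variation/= fin_numD !fin_num_measure.
have supS : has_sup S.
  split; first by exists (fine (m set0)); exists set0 => //; split.
  exists (fine (m setT)) => _ [N [mN _] <-].
  by rewrite fine_le ?mfin// le_measure ?inE.
have approx n : exists N, [/\ measurable N, mu N = 0%E & sup S - harmonic n < fine (m N)].
  have h0 : 0 < harmonic n :> R by rewrite /harmonic/= invr_gt0.
  have [_ [N [mN muN] <-] H] := sup_adherent h0 supS.
  by exists N.
pose Nn n := sval (cid (approx n)).
have NnP n : [/\ measurable (Nn n), mu (Nn n) = 0%E & sup S - harmonic n < fine (m (Nn n))].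
  by rewrite /Nn; case: cid.
pose N := \bigcup_n Nn n.
have mN : measurable N by apply: bigcupT_measurable => n; have [] := NnP n.
have muN : mu N = 0%E.
  apply/negligibleP => //; apply: negligible_bigcup => n; have [mn mun _] := NnP n.
  exact/negligibleP.
have supN : sup S <= fine (m N).
  have c0 : sup S - harmonic n @[n --> \oo] --> sup S.
    by rewrite -[X in _ --> X]subr0; apply: cvgB; [exact: cvg_cst|exact: cvg_harmonic].
  rewrite -(cvg_lim (@norm_hausdorff _ _) c0); apply: limr_le; first exact: cvgP c0.
  apply: nearW => n; have [mn mun H] := NnP n; apply: (le_trans (ltW H)).
  rewrite fine_le ?mfin// le_measure ?inE//.
  exact: bigcup_sup.
have null A : measurable A -> mu A = 0%E -> m (A `\` N) = 0%E.
  move=> mA muA.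
  have mD : measurable (A `\` N) by exact: measurableD.
  have mU : measurable ((A `\` N) `|` N) by exact: measurableU.
  have : fine (m ((A `\` N) `|` N)) <= sup S.
    apply: sup_upper_bound => //; exists ((A `\` N) `|` N) => //; split => //.
    by apply: null_set_setU => //; apply: subset_measure0 muA => //; exact: subDsetl.
  have -> : m ((A `\` N) `|` N) = (m (A `\` N) + m N)%E.
    by apply: measureU => //; rewrite setDKI.
  rewrite fineD ?mfin// => H.
  have m0 : fine (m (A `\` N)) = 0.
    apply/eqP; rewrite eq_le; apply/andP; split; last first.
      by apply: fine_ge0; exact: measure_ge0.
    by have := le_trans H supN; rewrite gerDr.
  by rewrite -(fineK (mfin _ mD)) m0.
have mCN : measurable (~` N) by exact: measurableC.
pose s : {charge set mR -> \bar R} := crestr0 nu mN.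
pose nuc : {charge set mR -> \bar R} := crestr0 nu mCN.
have nucE A : measurable A -> nuc A = nu (A `\` N).
  by move=> mA; rewrite /nuc/= /crestr0 mem_set// /crestr setDE.
have sE A : measurable A -> s A = nu (A `&` N).
  by move=> mA; rewrite /s/= /crestr0 mem_set.
have nuc_mu : nuc `<< mu.
  apply/null_content_dominatesP => A mA muA; rewrite nucE//.
  apply/eqP; rewrite -abse_eq0; apply/eqP/le_anti; rewrite abse_ge0 andbT.
  rewrite -(null _ mA muA); apply: abse_charge_variation.
  exact: measurableD.
pose g x := fine (Radon_Nikodym nuc mu x).
have gE A : measurable A -> nuc A = (\int[mu]_(x in A) (g x)%:E)%E.
  move=> mA; rewrite (Radon_Nikodym_integral nuc_mu mA); apply: eq_integral => x _.
  by rewrite /g fineK// Radon_Nikodym_fin_num.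
have ig : L1 g.
  apply: (@integrableS _ _ _ mu setT) => //.
  apply: eq_integrable (Radon_Nikodym_integrable nuc_mu) => // x _ /=.
  by rewrite /g fineK// Radon_Nikodym_fin_num.
exists g, s; split => //.
- exists N; split => //; rewrite /total_variation_charge /charge_variation/=.
  have [[mP _] [mM _] _ _] := hahn_posneg s.
  rewrite [X in (X + _)%E]jposE// [X in (_ + X)%E]jnegE// !sE; [|exact: measurableI..].
  have E B : ~` N `&` B `&` N = set0 by apply/seteqP; split => // x [[]].
  by rewrite !E charge0 oppe0 adde0.
- move=> A mA; rewrite sE// -gE//; last by apply: measurableI => //; exact: mI01.
  rewrite nucE; last by apply: measurableI => //; exact: mI01.
  rewrite (chargeDI nu mA mN); congr (_ + _)%E.
  have mD : measurable (A `\` N) by exact: measurableD.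
  rewrite (chargeDI nu mD mI01) [X in (X + _)%E]snu ?add0e.
  + by congr (nu _); apply/seteqP; split => x [[]].
  + by apply: measurableD => //; exact: mI01.
  + by apply/seteqP; split => // x [[]].
Qed.

(** Both Jordan parts are carried by the unit interval, where the primitive is bounded
    by M. *)
Lemma charge_integral_le (nu : {charge set (measurableTypeR R) -> \bar R}) (h : R -> R) (M : R) :
  supported01 nu -> measurable_fun I01 h -> 0 <= M -> (forall t, I01 t -> `|h t| <= M) ->
  `|charge_integral nu (prim h)| <= M * fine (total_variation_charge nu I01).
Proof.
move=> snu mh M0 hM.
have ih : L1 h by exact: L1_bounded hM.
have mI : measurable (I01 : set (measurableTypeR R)) by exact: mI01.
have mC : measurable (~` I01 : set (measurableTypeR R)) by exact: measurableC.
have key (m : {finite_measure set (measurableTypeR R) -> \bar R}) :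
    m (~` I01) = 0%E -> `|\int[m]_t prim h t| <= M * fine (m I01).
  move=> m0.
  have ip := integrable_prim m mh hM.
  apply: (le_trans (le_normr_Rintegral _ ip)) => //.
  have -> : m I01 = m setT.
    have := measureU m mI mC (setICr _); rewrite setUv => ->.
    by rewrite -[LHS]adde0; congr (_ + _)%E; exact: esym m0.
  rewrite -(Rintegral_cst m measurableT).
  apply: le_Rintegral => //.
  - exact: (integrable_norm ip).
  - exact: finite_measure_integrable_cst.
  - by move=> t _; exact: prim_bounded ih M0 hM t.
have [[mHp _] [mHn _] _ _] := hahn_posneg nu.
rewrite /charge_integral; apply: (le_trans (ler_normB _ _)).
rewrite /total_variation_charge /charge_variation/=.
rewrite fineD ?fin_num_measure// mulrDr.
apply: lerD; apply: key.
- rewrite [LHS]jposE//; apply: snu; first exact: measurableI.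
  by apply/seteqP; split => // x [[]].
- rewrite [LHS]jnegE// snu ?oppe0//; first exact: measurableI.
  by apply/seteqP; split => // x [[]].
Qed.

End lebesgue_decomposition.

(** * The energy gap *)
Section energy_gap.
Context {R : realType}.
Local Notation mu := (@lebesgue_measure R).
Local Notation I01 := (`]0%R, 1%R[%classic : set R).
Variables (F : R -> R) (nu1 lam a : R) (f u q s : R -> R).
Hypotheses (F1 : condF1 F) (F2 : condF2 nu1 F) (F4 : condF4 F).
Hypotheses (lam0 : 0 < lam) (mf : measurable_fun I01 f).
Hypothesis f01 : forall t, I01 t -> 0 <= f t <= 1.
Local Notation k := (fun t => lam * (u t - f t)).
Hypotheses (cu : continuous u) (cq : continuous q).
Hypotheses (u01 : forall x, 0 <= x <= 1 -> 0 <= u x <= 1).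
Hypotheses (uE : forall x, u x = a + prim q x) (sE : forall x, s x = prim k x).
Hypotheses (s1 : s 1 = 0) (F'q : forall x, derive1 F (q x) = s x).
Implicit Types (w g : R -> R).

Lemma F_ge0 (p : R) : 0 <= F p.
Proof.
have := F_above_tangent F1 F4 0 p.
by have [_ _ _ _ ->] := F1; rewrite (F'0 F1) mul0r addr0.
Qed.

Lemma L1_dominated g h : measurable_fun I01 g -> L1 h ->
  (forall t, I01 t -> `|g t| <= `|h t|) -> L1 g.
Proof.
move=> mg ih gh; apply: (le_integrable mI01 _ _ ih); first exact/measurable_EFinP.
by move=> t It; rewrite lee_fin gh.
Qed.

Lemma L1_F g : L1 g -> L1 (F \o g).
Proof.
move=> ig; apply: (L1_dominated _ (L1Z nu1 ig)).
  apply: measurableT_comp; last exact: L1_measurable.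
  by apply: continuous_measurable_fun; exact: continuous_F.
move=> t _; rewrite ger0_norm ?F_ge0//= normrM.
apply: (le_trans (F_le_norm F1 F2 F4 _)); rewrite ler_wpM2r//.
exact: ler_norm.
Qed.

Lemma k_measurable : measurable_fun I01 k.
Proof.
apply: measurable_funM => //; apply: measurable_funB => //.
by apply: measurable_funTS; exact: continuous_measurable_fun.
Qed.

Lemma u_f_le1 t : I01 t -> `|u t - f t| <= 1.
Proof.
move=> It; have := f01 It; move: It; rewrite /= in_itv/= => /andP[t0 t1].
have : 0 <= u t <= 1 by apply: u01; rewrite !ltW.
rewrite ler_norml; lra.
Qed.

Lemma k_le_lam t : I01 t -> `|k t| <= lam.
Proof. by move=> It; rewrite normrM (gtr0_norm lam0) ger_pMr// u_f_le1. Qed.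

Lemma u_k_pairing : \int[mu]_(x in I01) (u x * k x) = - \int[mu]_(x in I01) (q x * s x).
Proof.
have iq : L1 q by exact: L1_continuous.
have iu : L1 u by exact: L1_continuous.
have k1 : prim k 1 = 0 by rewrite -sE.
rewrite (@distf_integral _ a u (density_charge iq) k lam iu _ k_measurable k_le_lam k1).
- rewrite (density_charge_integral iq k_measurable k_le_lam k1); congr (- _).
  by apply: eq_Rintegral => x _; rewrite sE.
- by apply: aeW => x _; rewrite distf_density uE.
Qed.

Lemma L1_sqr_uf : L1 (fun t => (u t - f t) ^+ 2).
Proof.
apply: (L1_bounded (M := 1)).
  apply: measurable_funX; apply: measurable_funB => //.
  by apply: L1_measurable; exact: L1_continuous.
by move=> t /u_f_le1 H; rewrite normrX expr_le1.
Qed.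

Lemma L1_sqr_wu w : L1 w -> L1 (fun t => (w t - f t) ^+ 2) ->
  L1 (fun t => (w t - u t) ^+ 2).
Proof.
move=> iw iwf; apply: (L1_dominated _ (L1Z 2 (L1D iwf L1_sqr_uf))).
  apply: measurable_funX; apply: L1_measurable; apply: L1B => //.
  exact: L1_continuous.
move=> t _; rewrite !ger0_norm ?sqr_ge0//; last first.
  by rewrite mulr_ge0// addr_ge0// sqr_ge0.
have := sqr_ge0 ((w t - f t) + (u t - f t)); lra.
Qed.

(** The pointwise inequality
      F g + lam / 2 (w - f)^2 >=
        F q + lam / 2 (u - f)^2 + lam / 2 (w - u)^2 + s (g - q) + k (w - u)
    is the convexity of F, with F' q = s, and the expansion of the square. After integration
    the linear terms s q and k u cancel because s is the primitive of k vanishing at both ends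
    and q is the derivative of u; the terms s g and k w would cancel if g were the whole
    derivative of w, and V bounds what the singular part of that derivative contributes. *)
Lemma energy_gap_real w g (V : R) : L1 w -> L1 g ->
  L1 (fun t => (w t - f t) ^+ 2) ->
  - (\int[mu]_(x in I01) (w x * k x)) <= (\int[mu]_(x in I01) (g x * s x)) + V ->
  (\int[mu]_(x in I01) F (q x)) + lam / 2 * (\int[mu]_(x in I01) (u x - f x) ^+ 2)
    + lam / 2 * (\int[mu]_(x in I01) (w x - u x) ^+ 2) <=
  (\int[mu]_(x in I01) F (g x)) + V
    + lam / 2 * (\int[mu]_(x in I01) (w x - f x) ^+ 2).
Proof.
move=> iw ig iwf wg.
have iu : L1 u by exact: L1_continuous.
have iq : L1 q by exact: L1_continuous.
have ik : L1 k by exact: L1_bounded k_measurable k_le_lam.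
have s_le t : `|s t| <= lam by rewrite sE; apply: prim_bounded ik (ltW lam0) k_le_lam t.
have ms : measurable_fun I01 s.
  rewrite (_ : s = prim k); last exact/funext.
  apply: measurable_funTS; apply: continuous_measurable_fun.
  exact: prim_continuous k_measurable (ltW lam0) k_le_lam.
have iFq := L1_F iq.
have iFg := L1_F ig.
have igs : L1 (fun t => g t * s t) by apply: (L1M (M := lam)).
have iqs : L1 (fun t => q t * s t) by apply: (L1M (M := lam)).
have iwk : L1 (fun t => w t * k t) by exact: L1M k_measurable k_le_lam.
have iuk : L1 (fun t => u t * k t) by exact: L1M k_measurable k_le_lam.
have iuf := L1_sqr_uf.
have iwu := L1_sqr_wu iw iwf.
pose c := lam / 2.
have : \int[mu]_(t in I01) ((F (q t) + c * (u t - f t) ^+ 2 + c * (w t - u t) ^+ 2)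
      + (g t * s t + w t * k t)) <=
    \int[mu]_(t in I01) ((F (g t) + c * (w t - f t) ^+ 2) + (q t * s t + u t * k t)).
  have iL1 := L1D (L1D iFq (L1Z c iuf)) (L1Z c iwu).
  have iL2 := L1D iL1 (L1D igs iwk).
  have iR2 := L1D (L1D iFg (L1Z c iwf)) (L1D iqs iuk).
  apply: le_Rintegral => //.
  move=> t It; have := F_above_tangent F1 F4 (q t) (g t); rewrite F'q /c /=.
  lra.
have i2 := L1D iFq (L1Z c iuf).
have i3 := L1D iFg (L1Z c iwf).
have i4 := L1D i2 (L1Z c iwu).
rewrite !RintegralD//; try exact: L1Z; try exact: L1D.
rewrite !RintegralZl// u_k_pairing -/c; move: wg; lra.
Qed.

Lemma L1_integralE h : L1 h ->
  (\int[mu]_(x in I01) (h x)%:E)%E = (\int[mu]_(x in I01) h x)%:E.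
Proof. by move=> ih; rewrite /Rintegral fineK//; exact: integrable_fin_num ih. Qed.

(** If w - f is not square integrable the right-hand side is infinite; otherwise every
    integral is finite. *)
Lemma energy_gap w g (V : R) : L1 w -> L1 g -> 0 <= V ->
  - (\int[mu]_(x in I01) (w x * k x)) <= (\int[mu]_(x in I01) (g x * s x)) + V ->
  (\int[mu]_(x in I01) (F (q x))%:E
    + (lam / 2)%:E * \int[mu]_(x in I01) ((u x - f x) ^+ 2)%:E
    + (lam / 2)%:E * \int[mu]_(x in I01) ((w x - u x) ^+ 2)%:E <=
   \int[mu]_(x in I01) (F (g x))%:E + V%:E
    + (lam / 2)%:E * \int[mu]_(x in I01) ((w x - f x) ^+ 2)%:E)%E.
Proof.
move=> iw ig V0 wg.
have mwf : measurable_fun I01 (fun t => (w t - f t) ^+ 2).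
  by apply: measurable_funX; apply: measurable_funB => //; exact: L1_measurable.
have wf0 : (0 <= \int[mu]_(x in I01) ((w x - f x) ^+ 2)%:E)%E.
  by apply: integral_ge0 => x _; rewrite lee_fin sqr_ge0.
have [wfoo|wfoo] := eqVneq (\int[mu]_(x in I01) ((w x - f x) ^+ 2)%:E)%E +oo%E.
  rewrite wfoo gt0_muley ?lte_fin ?divr_gt0// addey ?leey//.
  by rewrite (L1_integralE (L1_F ig)) -EFinD.
have iwf : L1 (fun t => (w t - f t) ^+ 2).
  apply/integrableP; split; first exact/measurable_EFinP.
  under eq_integral do rewrite /= ger0_norm ?sqr_ge0//.
  by rewrite ltey.
have := energy_gap_real iw ig iwf wg.
rewrite (L1_integralE (L1_F (L1_continuous cq))) (L1_integralE (L1_F ig)).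
rewrite (L1_integralE L1_sqr_uf) (L1_integralE (L1_sqr_wu iw iwf)) (L1_integralE iwf).
by rewrite -!EFinM -!EFinD lee_fin.
Qed.

End energy_gap.

(** * Sobolev and BV functions *)
Section function_spaces.
Context {R : realType}.
Local Notation mu := (@lebesgue_measure R).
Local Notation I01 := (`]0%R, 1%R[%classic : set R).
Local Notation mR := (measurableTypeR R).
Implicit Types (nu s : {charge set mR -> \bar R}) (w g h : R -> R).

Lemma weak_derivativeP w : W11 w -> is_weak_derivative w (weak_derivative w).
Proof. by move=> [_ [g wg]]; exact: (xgetI _ wg). Qed.

Lemma distributional_derivativeP w : BV w ->
  is_distributional_derivative w (distributional_derivative w).
Proof. by move=> [nu wnu]; apply: (xgetI _ wnu). Qed.

(** The density and the singular part are chosen separately, possibly from two different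
    decompositions; by uniqueness they still belong together. *)
Lemma BV_decomposition w : BV w ->
  is_lebesgue_decomposition (distributional_derivative w) (ac_density w)
    (singular_part w).
Proof.
move=> /distributional_derivativeP[_ snu _].
have [g [s gs]] := lebesgue_decomposition_exists snu.
have [s1 gs1] : [set g | exists s, is_lebesgue_decomposition
    (distributional_derivative w) g s] (ac_density w) by apply: xgetPex; exists g, s.
have [g2 gs2] : [set s | exists g, is_lebesgue_decomposition
    (distributional_derivative w) g s] (singular_part w).
  by apply: xgetPex; exists s, g.
have [s12 _] := lebesgue_decomposition_uniq gs1 gs2.
have [ig _ H] := gs1; have [_ sing _] := gs2; split => // A mA.
by rewrite -s12// H.
Qed.

Lemma singular_supported nu g s : supported01 nu -> is_lebesgue_decomposition nu g s ->
  supported01 s.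
Proof.
move=> snu [_ _ H] A mA A0; have := H _ mA; rewrite snu// A0 integral_set0 add0e.
by move=> <-.
Qed.

Lemma distf_decomposition nu g s x : is_lebesgue_decomposition nu g s ->
  distf nu x = prim g x + distf s x.
Proof.
move=> [ig _ H].
have mr : measurable (`]-oo, x[ : set mR) by exact: measurable_itv.
rewrite /distf H// -density_chargeE fineD ?charge_fin//.
by congr (_ + _); exact: distf_density.
Qed.

(** Through distribution functions, which add up, the identity reduces to integration by parts
    for each of the two parts. *)
Lemma charge_integral_decomposition nu g s h (M : R) :
  is_lebesgue_decomposition nu g s -> measurable_fun I01 h ->
  (forall t, I01 t -> `|h t| <= M) -> prim h 1 = 0 ->
  charge_integral nu (prim h) =
  (\int[mu]_(x in I01) (g x * prim h x)) + charge_integral s (prim h).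
Proof.
move=> gs mh hM h1; have [ig _ _] := gs.
rewrite !(charge_integral_prim _ mh hM h1).
have idh : L1 (fun x => distf s x * h x) by apply: (L1M (M := M)) => //; exact: L1_distf.
have igh : L1 (fun x => prim g x * h x).
  apply: (L1M (M := M)) => //.
  apply: eq_integrable (L1_distf (density_charge ig)) => //.
  by move=> x _; rewrite /= distf_density.
have -> : \int[mu]_(x in I01) (distf nu x * h x) =
    \int[mu]_(x in I01) (prim g x * h x + distf s x * h x).
  by apply: eq_Rintegral => x _; rewrite (distf_decomposition _ gs) mulrDl.
rewrite RintegralD//.
by rewrite (prim_by_parts ig mh hM h1) opprD opprK.
Qed.

Lemma density_decomposition g (ig : L1 g) :
  is_lebesgue_decomposition (density_charge ig) g (czero : {charge set mR -> \bar R}).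
Proof.
split => //; last by move=> A mA; rewrite density_chargeE /czero/= adde0.
exists set0; split => //.
by rewrite setC0 total_variation_czero.
Qed.

(** A null set contains no interval, so that the functions agree on a dense subset. *)
Lemma eq_ae_continuous (v w : R -> R) : {within `[0%R, 1%R], continuous v} ->
  {within `[0%R, 1%R], continuous w} ->
  (\forall x \ae mu, I01 x -> v x = w x) -> {in `[0%R, 1%R], v =1 w}.
Proof.
move=> cv cw [N [mN N0 HN]] x; rewrite inE => x01.
have /andP[x0 x1] : 0 <= x <= 1 by move: x01; rewrite /= in_itv.
have near_eq (e : R) : 0 < e -> exists y, [/\ I01 y, `|y - x| < e & v y = w y].
  move=> e0; apply: contrapT => H.
  have : mu `]Num.max 0 (x - e), Num.min 1 (x + e)[%classic = 0%E.
    apply: subset_measure0 N0 => //.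
    move=> y /=; rewrite in_itv/= gt_max lt_min => /andP[/andP[y0 xy] /andP[y1 yx]].
    apply: HN => /= vw; apply: H; exists y; split; last apply: vw.
    - by rewrite /= in_itv/= y0.
    - by rewrite ltr_norml; apply/andP; split; lra.
    - by rewrite in_itv/= y0.
  rewrite lebesgue_measure_itv/= lte_fin.
  have lt : Num.max 0 (x - e) < Num.min 1 (x + e).
    by rewrite gt_max !lt_min; apply/andP; split; apply/andP; split; lra.
  rewrite lt -EFinB => -[]; lra.
have close (h : R -> R) (e : R) : {within `[0%R, 1%R], continuous h} -> 0 < e ->
    exists2 d, 0 < d & forall y, I01 y -> `|y - x| < d -> `|h x - h y| < e.
  move=> /subspace_continuousP ch e0.
  have /cvgrPdist_lt/(_ _ e0)/nbhs_ballP[d /= d0 Hd] := ch _ x01.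
  exists d => // y; rewrite /= in_itv/= => /andP[y0 y1] yxd; apply: Hd.
    by rewrite /ball/= distrC.
  by rewrite /= in_itv/= !ltW.
apply/eqP; rewrite -subr_eq0 -normr_le0; apply/ler_addgt0Pl => e e0; rewrite addr0.
have e20 : 0 < e / 2 by rewrite divr_gt0.
have [d1 d10 H1] := close v _ cv e20.
have [d2 d20 H2] := close w _ cw e20.
have d0 : 0 < Num.min d1 d2 by rewrite lt_min d10.
have [y [Iy + vw]] := near_eq _ d0; rewrite lt_min => /andP[yd1 yd2].
have -> : v x - w x = (v x - v y) - (w x - w y) by rewrite vw; ring.
apply: (le_trans (ler_normB _ _)); rewrite (splitr e).
by apply: lerD; apply: ltW; [exact: H1|exact: H2].
Qed.

Lemma Linfty_bounded h (M : R) : measurable_fun I01 h ->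
  (forall t, I01 t -> `|h t| <= M) -> Linfty h.
Proof.
move=> mh hM; rewrite /Linfty; apply/andP; split.
  by rewrite inE/=; apply: (measurable_restrictT _ _).1 => //; exact: mI01.
rewrite inE/= /finite_norm unlock; case: ifP => // _.
apply: (@le_lt_trans _ _ M%:E); last by rewrite ltry.
apply/ess_supP; apply: aeW => x /=; rewrite lee_fin patchE; case: ifPn => [|_].
  by rewrite inE; exact: hM.
rewrite normr0; apply: (le_trans (normr_ge0 (h (2^-1)))).
by apply: hM; rewrite /= in_itv/=; lra.
Qed.

Lemma Linfty_measurable h : Linfty h -> measurable_fun I01 h.
Proof.
move=> /andP[]; rewrite inE/= => mh _.
by apply/measurable_restrictT.
Qed.

(** This is what makes limits of difference quotients unique, in particular the one-sided
    ones at the endpoints. *)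
Lemma punctured_nbhs_proper (x : R) : 0 <= x <= 1 ->
  ProperFilter (within `[0%R, 1%R]%classic x^').
Proof.
move=> /andP[x0 x1]; apply: Build_ProperFilter_ex => A /nbhs_ballP[e /= e0 He].
pose d := Num.min e 1 / 3.
have d1 : 0 < d by rewrite divr_gt0// lt_min e0 ltr01.
have de : d < e.
  rewrite ltr_pdivrMr//; apply: (@le_lt_trans _ _ e); first by rewrite ge_min lexx.
  lra.
have d3 : d <= 1 / 3 by rewrite ler_pM2r// ge_min lexx orbT.
have [xh|xh] := leP x (1 / 2).
  exists (x + d); apply: He.
  - by rewrite /ball/= opprD addrA subrr sub0r normrN gtr0_norm.
  - by rewrite gt_eqF// ltrDl.
  - by rewrite /= in_itv/=; lra.
exists (x - d); apply: He.
- by rewrite /ball/= opprB addrC subrK gtr0_norm.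
- by rewrite lt_eqF// gtrDl oppr_lt0.
- by rewrite /= in_itv/=; lra.
Qed.

Lemma prim_derivative01 (a : R) u q (x : R) : continuous q ->
  (forall x, u x = a + prim q x) -> 0 <= x <= 1 ->
  difference_quotient u x y @[y --> within `[0%R, 1%R]%classic x^'] --> q x.
Proof.
move=> cq uE x01; apply/cvgrPdist_le => e e0.
have /cvgrPdist_le/(_ _ e0)/nbhs_ballP[d /= d0 Hd] := cq x.
apply/nbhs_ballP; exists d => // y yxd yx y01.
have xyd : `|y - x| < d by rewrite distrC.
have := @prim_approx _ q x e d (L1_continuous cq) x01 _ y _ xyd.
have yx0 : y - x != 0 by rewrite subr_eq0.
have -> : q x - difference_quotient u x y =
    - ((prim q y - prim q x - q x * (y - x)) / (y - x)).
  by rewrite /difference_quotient !uE; field.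
rewrite normrN normrM normfV ler_pdivrMr ?normr_gt0//; apply.
- by move=> t t01 txd; rewrite distrC; apply: Hd; rewrite /ball/= distrC.
- by move: y01; rewrite /= in_itv.
Qed.

Lemma derivative01_prim (a : R) u q (x : R) : continuous q ->
  (forall x, u x = a + prim q x) -> 0 <= x <= 1 -> derivative01 u x = q x.
Proof.
move=> cq uE x01; apply: cvg_lim => //.
  exact: punctured_nbhs_proper.
exact: prim_derivative01 uE x01.
Qed.

Lemma C11_prim (a M : R) u q h : continuous q -> 0 <= M -> L1 h ->
  (forall t, I01 t -> `|h t| <= M) ->
  (forall x, u x = a + prim q x) -> (forall x, 0 <= x <= 1 -> q x = prim h x) -> C11 u.
Proof.
move=> cq M0 ih hM uE qE; split=> [x|].
  rewrite inE /= in_itv/= => x01; apply: cvgP.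
  exact: prim_derivative01 cq uE x01.
exists M => -[x y] [/=]; rewrite !in_itv/= => x01 y01.
rewrite (derivative01_prim cq uE x01) (derivative01_prim cq uE y01) !qE//.
exact: prim_sub_le.
Qed.

End function_spaces.

(** * The minimizer *)
(** The bounds on the datum f hold almost everywhere only; fh is a modification of f on a null
    set for which they hold everywhere on (0, 1). The Euler equation is solved for fh, while the
    energies are those of f. *)
Section minimizer.
Context {R : realType}.
Local Notation mu := (@lebesgue_measure R).
Local Notation I01 := (`]0%R, 1%R[%classic : set R).
Local Notation mR := (measurableTypeR R).
Variables (F : R -> R) (nu1 lam a : R) (f fh u q s : R -> R).
Hypotheses (F1 : condF1 F) (F2 : condF2 nu1 F) (F4 : condF4 F).
Hypotheses (lam0 : 0 < lam) (lamF : lam < lambda_infty F).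
Hypotheses (mf : measurable_fun I01 f) (mfh : measurable_fun I01 fh).
Hypothesis fh01 : forall t, I01 t -> 0 <= fh t <= 1.
Hypothesis f_fh : \forall t \ae mu, I01 t -> f t = fh t.
Local Notation k := (fun t => lam * (u t - fh t)).
Hypotheses (cu : continuous u) (cq : continuous q).
Hypotheses (u01 : forall x, 0 <= x <= 1 -> 0 <= u x <= 1).
Hypotheses (uE : forall x, u x = a + prim q x) (sE : forall x, s x = prim k x).
Hypotheses (s1 : s 1 = 0) (F'q : forall x, derive1 F (q x) = s x).
Implicit Types (w v g : R -> R).

Local Notation dist2 w v := (\int[mu]_(t in I01) ((w t - v t) ^+ 2)%:E)%E.
Local Notation c := ((lam / 2)%:E).
Local Notation E0 := (\int[mu]_(t in I01) (F (q t))%:E + c * dist2 u fh)%E.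

Lemma dist2_f w : L1 w -> dist2 w f = dist2 w fh.
Proof.
move=> iw; have mw := L1_measurable iw; apply: ae_eq_integral => //.
- by apply/measurable_EFinP; apply: measurable_funX; exact: measurable_funB.
- by apply/measurable_EFinP; apply: measurable_funX; exact: measurable_funB.
- by apply: ae_imp f_fh => t H It; rewrite H.
Qed.

Lemma dist2_ge0 w v : (0 <= dist2 w v)%E.
Proof. by apply: integral_ge0 => t _; rewrite lee_fin sqr_ge0. Qed.

Lemma measurable_F g : measurable_fun I01 g -> measurable_fun I01 (F \o g).
Proof.
by apply: measurableT_comp; apply: continuous_measurable_fun; exact: continuous_F.
Qed.

Lemma integral_F_ae g1 g2 : L1 g1 -> L1 g2 -> (\forall t \ae mu, I01 t -> g1 t = g2 t) ->
  (\int[mu]_(t in I01) (F (g1 t))%:E = \int[mu]_(t in I01) (F (g2 t))%:E)%E.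
Proof.
move=> i1 i2 g12; apply: ae_eq_integral => //.
- by apply/measurable_EFinP; apply: measurable_F; exact: L1_measurable.
- by apply/measurable_EFinP; apply: measurable_F; exact: L1_measurable.
- by apply: ae_imp g12 => t H It; rewrite H.
Qed.

Lemma k1 : prim k 1 = 0. Proof. by rewrite -sE. Qed.

Lemma u_weak : is_weak_derivative u q.
Proof. by apply: (prim_weak (c := a)) => //; exact: L1_continuous. Qed.

Lemma u_W11 : W11 u.
Proof. by split; [exact: continuous_subspaceT|exists q; exact: u_weak]. Qed.

Lemma J_u : J F f lam u = E0.
Proof.
have [iu iq _] := u_weak; have [_ i' _] := weak_derivativeP u_W11.
rewrite /J dist2_f//; congr (_ + _)%E; apply: integral_F_ae => //.
exact: weak_unique (weak_derivativeP u_W11) u_weak.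
Qed.

Lemma J_gap w : W11 w -> (E0 + c * dist2 w u <= J F f lam w)%E.
Proof.
move=> wW; have w' := weak_derivativeP wW; have [iw ig _] := w'.
have mk := k_measurable lam mfh cu.
have kM := k_le_lam lam0 fh01 u01.
rewrite /J dist2_f//.
have := energy_gap F1 F2 F4 lam0 mfh fh01 cu cq u01 uE sE s1 F'q iw ig (lexx 0).
rewrite adde0; apply.
rewrite (distributional_pairing (weak_distributional ig w') mk kM k1) opprK addr0.
rewrite (density_charge_integral ig mk kM k1).
by under eq_Rintegral do rewrite -sE.
Qed.

Lemma u_distributional (iq : L1 q) : is_distributional_derivative u (density_charge iq).
Proof. exact: weak_distributional u_weak. Qed.

Lemma u_BV : BV u.
Proof. by have [_ iq _] := u_weak; exists (density_charge iq); exact: u_distributional. Qed.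

(** The derivative q of u is a density of Du, and the zero charge completes it to a Lebesgue
    decomposition. *)
Lemma K_u : K F f lam u = E0.
Proof.
have [iu iq _] := u_weak.
have Du := distributional_derivativeP u_BV.
have [iac _ _] := BV_decomposition u_BV.
have dec : is_lebesgue_decomposition (distributional_derivative u) q
    (czero : {charge set mR -> \bar R}).
  have [_ sing H] := density_decomposition iq; split => // A mA.
  by rewrite -H//; exact: (distributional_unique Du (u_distributional iq)).
have [s0 gq] := lebesgue_decomposition_uniq (BV_decomposition u_BV) dec.
rewrite /K dist2_f// (integral_F_ae iac iq gq).
rewrite (total_variation_eq s0); last exact: mI01.
rewrite total_variation_czero; last exact: mI01.
by rewrite mule0 adde0.
Qed.

Lemma K_gap w : BV w -> (E0 + c * dist2 w u <= K F f lam w)%E.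
Proof.
move=> wB; have Dw := distributional_derivativeP wB.
have dec := BV_decomposition wB; have [iw snu _] := Dw; have [ig _ _] := dec.
have ss := singular_supported snu dec.
have mk := k_measurable lam mfh cu.
have kM := k_le_lam lam0 fh01 u01.
set V := total_variation_charge (singular_part w) I01.
have Vfin : V \is a fin_num by apply: total_variation_fin; exact: mI01.
have V0 : 0 <= fine V by apply: fine_ge0; exact: total_variation_charge_ge0.
rewrite /K dist2_f//.
have VL : 0 <= lambda_infty F * fine V by rewrite mulr_ge0// ltW// (lt_trans lam0).
have := energy_gap F1 F2 F4 lam0 mfh fh01 cu cq u01 uE sE s1 F'q iw ig VL.
rewrite (EFinM (lambda_infty F)) fineK//; apply.
rewrite (distributional_pairing Dw mk kM k1) opprK.
rewrite (charge_integral_decomposition dec mk kM k1).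
under [X in _ <= X + _]eq_Rintegral do rewrite sE.
rewrite lerD2l.
apply: (le_trans (ler_norm _)).
apply: (le_trans (charge_integral_le ss mk (ltW lam0) kM)).
by rewrite ler_wpM2r// ltW.
Qed.

Lemma E0_fin : E0 \is a fin_num.
Proof.
rewrite (L1_integralE (L1_F F1 F2 F4 (L1_continuous cq))).
by rewrite (L1_integralE (L1_sqr_uf mfh fh01 cu u01)).
Qed.

(** The quadratic term in the gap is what forces uniqueness. *)
Lemma gap_unique (E : \bar R) v : L1 v -> (E0 + c * dist2 v u <= E)%E ->
  (E <= E0)%E -> \forall t \ae mu, I01 t -> v t = u t.
Proof.
move=> iv gap le.
have d0 := dist2_ge0 v u.
have : (c * dist2 v u <= 0)%E.
  have := le_trans gap le; rewrite -leeBrDl ?E0_fin// subee ?E0_fin//.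
rewrite pmule_rle0 ?lte_fin ?divr_gt0// => d1.
have d2 : dist2 v u = 0%E by apply/eqP; rewrite eq_le d1 d0.
have mvu : measurable_fun I01 (fun t => (v t - u t) ^+ 2).
  apply: measurable_funX; apply: L1_measurable; apply: L1B => //.
  exact: L1_continuous.
have : ae_eq mu I01 (fun t => ((v t - u t) ^+ 2)%:E) (cst 0%E).
  have mE : measurable_fun I01 (EFin \o (fun t => (v t - u t) ^+ 2)) by exact/measurable_EFinP.
  have [H _] := @ae_eq_integral_abs _ _ R mu _ (@mI01 R) _ mE; apply: H.
  by under eq_integral do rewrite /= ger0_norm ?sqr_ge0//.
apply: ae_imp => t H It; apply/eqP; rewrite -subr_eq0 -sqrf_eq0.
by have [->] := H It.
Qed.

Hypothesis qE : forall x, 0 <= x <= 1 ->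
  q x = prim (fun t => lam * (u t - fh t) / derive1 (derive1 F) (q t)) x.
Local Notation q' := (fun t => lam * (u t - fh t) / derive1 (derive1 F) (q t)).

Lemma q'_bounded : measurable_fun I01 q' /\ exists B, forall t, I01 t -> `|q' t| <= B.
Proof.
exact: div_F''_bounded (k_measurable lam mfh cu) (k_le_lam lam0 fh01 u01) cq.
Qed.

Lemma q_weak : is_weak_derivative q q'.
Proof.
have [mq' [B hB]] := q'_bounded.
apply: (prim_weak (c := 0)); first exact: L1_continuous.
- exact: L1_bounded hB.
- move=> x; rewrite /= in_itv/= add0r => /andP[x0 x1].
  by rewrite qE// !ltW.
Qed.

Lemma Linfty_continuous (h : R -> R) : continuous h -> Linfty h.
Proof.
move=> ch; have [M _ hM] := continuous_bounded01 ch.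
apply: (Linfty_bounded (M := M)) => //.
by apply: L1_measurable; exact: L1_continuous.
Qed.

Lemma u_W2infty : W2infty u.
Proof.
have [mq' [B hB]] := q'_bounded.
exists q, q'; split; [exact: u_weak|exact: q_weak|exact: Linfty_continuous..|].
exact: Linfty_bounded hB.
Qed.

Lemma u_C11 : C11 u.
Proof.
have [mq' [B hB]] := q'_bounded.
have B0 : 0 <= B.
  by apply: (le_trans (normr_ge0 (q' (2^-1)))); apply: hB; rewrite /= in_itv/=; lra.
exact: C11_prim cq B0 (L1_bounded mq' hB) hB uE qE.
Qed.

Lemma u_euler_lagrange : \forall x \ae mu, I01 x ->
  weak_derivative (weak_derivative u) x
  = lam * ((u x - f x) / derive1 (derive1 F) (weak_derivative u x)).
Proof.
have Wu := weak_derivativeP u_W11.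
have wq := weak_unique Wu u_weak.
have [_ iW _] := Wu.
have Wq : is_weak_derivative (weak_derivative u) q'.
  have [iq iq' H] := q_weak; split => // phi tphi; rewrite -H//.
  have [h [M [mh hM _ _ <-]]] := test_prim tphi.
  apply: eq_ae_Rintegral.
  - by apply: measurable_funM => //; exact: L1_measurable.
  - by apply: measurable_funM => //; exact: L1_measurable.
  - by apply: ae_imp wq => x E Ix; rewrite E.
have W' : is_weak_derivative (weak_derivative u) (weak_derivative (weak_derivative u)).
  exact: (xgetI _ Wq).
have E2 : \forall x \ae mu, I01 x -> weak_derivative u x = q x /\ f x = fh x.
  by apply: ae_imp2 wq f_fh => x H1 H2 Ix; rewrite H1// H2.
apply: ae_imp2 (weak_unique W' Wq) E2 => x H1 H2 Ix.
by rewrite H1//; have [-> ->] := H2 Ix; rewrite mulrA.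
Qed.

Lemma J_minimizer : minimizes (J F f lam) W11 u.
Proof.
split=> [|w wW]; first exact: u_W11.
rewrite J_u; apply: le_trans (J_gap wW); apply: leeDl.
apply: mule_ge0; [by rewrite lee_fin divr_ge0// ltW|exact: dist2_ge0].
Qed.

Lemma K_minimizer : minimizes (K F f lam) BV u.
Proof.
split=> [|w wB]; first exact: u_BV.
rewrite K_u; apply: le_trans (K_gap wB); apply: leeDl.
apply: mule_ge0; [by rewrite lee_fin divr_ge0// ltW|exact: dist2_ge0].
Qed.

Lemma J_minimizer_unique v : minimizes (J F f lam) W11 v ->
  {in `[0%R, 1%R], v =1 u}.
Proof.
move=> [vW vmin]; have [cv _] := vW; have [iv _ _] := weak_derivativeP vW.
apply: eq_ae_continuous => //; first exact: continuous_subspaceT.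
by apply: gap_unique iv (J_gap vW) _; rewrite -J_u; apply: vmin; exact: u_W11.
Qed.

Lemma K_minimizer_unique v : minimizes (K F f lam) BV v ->
  \forall t \ae mu, I01 t -> v t = u t.
Proof.
move=> [vB vmin]; have [iv _ _] := distributional_derivativeP vB.
by apply: gap_unique iv (K_gap vB) _; rewrite -K_u; apply: vmin; exact: u_BV.
Qed.

End minimizer.

Theorem theorem1p1 (R : realType) (f F : R -> R) (nu1 nu2 nu3 lam : R)
  (f_Linfty : Linfty f)
  (f_01 : \forall x \ae lebesgue_measure, `]0, 1[%classic x -> 0 <= f x <= 1)
  (F_ge0 : forall p, 0 <= F p)
  (nu1_gt0 : 0 < nu1) (nu2_gt0 : 0 < nu2)
  (F1 : condF1 F) (F2 : condF2 nu1 F) (F3 : condF3 nu2 nu3 F) (F4 : condF4 F)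
  (lam_gt0 : 0 < lam) (lam_lt : lam < lambda_infty F) :
  exists u : R -> R,
    [/\ minimizes (J F f lam) W11 u,
        (forall v, minimizes (J F f lam) W11 v -> {in `[0, 1], v =1 u}) &
        {in `[0, 1], forall x, 0 <= u x <= 1}]
    /\ (minimizes (K F f lam) BV u
        /\ forall v, minimizes (K F f lam) BV v ->
             v = u %[ae lebesgue_measure in `]0, 1[%classic])
    /\ [/\ W2infty u, C11 u,
        (\forall x \ae lebesgue_measure, `]0, 1[%classic x ->
           weak_derivative (weak_derivative u) x
           = lam * ((u x - f x) / derive1 (derive1 F) (weak_derivative u x))),
        derivative01 u 0 = 0 & derivative01 u 1 = 0].
Proof.
(* the clamp changes f on a null set only *)
pose fh x := clamp 0 1 (f x).
have mf := Linfty_measurable f_Linfty.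
have fh01 (t : R) (_ : (`]0%R, 1%R[%classic : set R) t) : 0 <= fh t <= 1.
  exact: clamp_itv.
have mfh : measurable_fun (`]0%R, 1%R[%classic : set R) fh.
  apply: measurable_maxr; first exact: measurable_cst.
  by apply: measurable_minr => //; exact: measurable_cst.
have f_fh : \forall t \ae lebesgue_measure, (`]0%R, 1%R[%classic : set R) t -> f t = fh t.
  by apply: ae_imp f_01 => t H It; rewrite /fh clamp_id// H.
have [a [u [q [s [[cu cq cs] [uE sE qE] [s1 q0 q1] u01 [_ F'q]]]]]] :=
  regular_solution F1 F4 lam_gt0 lam_lt mfh fh01.
exists u; split; [split|split; [split|split]].
- exact: (J_minimizer F1 F2 F4 lam_gt0 mf mfh fh01 f_fh cu cq u01 uE sE s1 F'q).
- exact: (J_minimizer_unique F1 F2 F4 lam_gt0 mf mfh fh01 f_fh cu cq u01 uE sE s1 F'q).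
- by move=> x; rewrite inE/= in_itv/=; exact: u01.
- exact: (K_minimizer F1 F2 F4 lam_gt0 lam_lt mf mfh fh01 f_fh cu cq u01 uE sE s1 F'q).
- exact: (K_minimizer_unique F1 F2 F4 lam_gt0 lam_lt mf mfh fh01 f_fh cu cq u01 uE sE
    s1 F'q).
- exact: (u_W2infty F1 F4 lam_gt0 mfh fh01 cu cq u01 uE qE).
- exact: (u_C11 F1 F4 lam_gt0 mfh fh01 cu cq u01 uE qE).
- exact: (u_euler_lagrange F1 F4 lam_gt0 mfh fh01 f_fh cu cq u01 uE qE).
- by rewrite (derivative01_prim cq uE)// lexx ler01.
- by rewrite (derivative01_prim cq uE)// lexx ler01.
Qed.
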